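(* Let $1\le k\le n$, let $\Omega\subset\mathbb{R}^{2n+1-k}$ be an open set and let $\phi:\Omega\to\mathbb{R}^k$ be a continuous function. Then the following conditions are equivalent: (i) $\phi$ is uniformly intrinsic differentiable on $\Omega$; (ii) there exist a family of maps $\{\phi_\varepsilon\}_{\varepsilon>0}\subset C^1(\Omega,\mathbb{R}^k)$ and a continuous matrix-valued function $M\in C^0(\Omega,M_{k,2n-k}(\mathbb{R}))$ such that, for any open set $\Omega'\Subset\Omega$, $$\phi_\varepsilon\to\phi\qquad\text{and}\qquad J^{\phi_\varepsilon}\phi_\varepsilon\to M$$ uniformly on $\Omega'$ as $\varepsilon\to0$.
   Context: Fix integers $1\le k\le n$. Points of $\mathbb{R}^{2n+1-k}$ are written $a=(v_{k+1},\dots,v_n,\eta_1,\dots,\eta_k,w_{k+1},\dots,w_n,\tau)$, and similarly $a'=(v',\eta',w',\tau')$. Set $\sigma(v,w,v',w'):=\frac12\sum_{j=k+1}^n(v_jw_j'-v_j'w_j)$ and equip $\mathbb{R}^{2n+1-k}$ with the group law $a\star a'=(v+v',\eta+\eta',w+w',\tau+\tau'+\sigma(v,w,v',w'))$ (so $a^{-1}=-a$). Let $\pi:\mathbb{R}^{2n+1-k}\to\mathbb{R}^{2n-k}$ be the projection on the first $2n-k$ coordinates, $|\cdot|$ the Euclidean norm, and $I_r(a):=\{p: |p_i-a_i|<r,\ i=1,\dots,2n+1-k\}$. For $\phi=(\phi_1,\dots,\phi_k):\Omega\to\mathbb{R}^k$ with $\Omega\subset\mathbb{R}^{2n+1-k}$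 open, define, for $a,a'\in\Omega$, $$d_\phi(a,a')=\max\Big\{|\pi(a)-\pi(a')|,\ \Big|\tau-\tau'+\sum_{j=1}^k\phi_j(a')(\eta_j'-\eta_j)+\sigma(v,w,v',w')\Big|^{1/2}\Big\}.$$ A $\star$-linear map $L:\mathbb{R}^{2n+1-k}\to\mathbb{R}^k$ is a homomorphism $(\mathbb{R}^{2n+1-k},\star)\to(\mathbb{R}^k,+)$ homogeneous of degree one with respect to the dilations $(v,\eta,w,\tau)\mapsto(\lambda v,\lambda\eta,\lambda w,\lambda^2\tau)$, $\lambda>0$; these are exactly the maps $L(p)=M_L\,\pi(p)^T$ with $M_L\in M_{k,2n-k}(\mathbb{R})$ (real $k\times(2n-k)$ matrices). $\phi$ is intrinsic differentiable at $a_0\in\Omega$ if there is a $\star$-linear $L$ with $\lim_{a\to a_0}\frac{|\phi(a)-\phi(a_0)-L(a_0^{-1}\star a)|}{d_\phi(a,a_0)}=0$; such $L$ is unique and the intrinsic Jacobian matrix of $\phi$ at $a_0$ is $J^\phi\phi(a_0):=M_L$. (Every $C^1$ function is intrinsic differentiable at every point.) $\phi$ is uniformly intrinsic differentiable at $a_0$ if there is a $\star$-linear $L$ with $$\lim_{r\to0}\ \sup_{a,b\in I_r(a_0),\,a\ne b}\frac{|\phi(b)-\phi(a)-L(a^{-1}\star b)|}{d_\phi(b,a)}=0,$$ and on $\Omega$ if this holds at every point of $\Omega$. $\Omega'\Subset\Omega$ means that $\overline{\Omega'}$ is compact and contained in $\Omega$. *)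

(* Defs.v *)
From HB Require Import structures.
From mathcomp Require Import all_boot all_order all_algebra.
From mathcomp Require Import all_classical all_reals all_analysis.
Set Implicit Arguments.
Unset Strict Implicit.
Unset Printing Implicit Defensive.
Import Order.TTheory GRing.Theory Num.Theory.
Import numFieldNormedType.Exports.
Local Open Scope classical_set_scope.
Local Open Scope ring_scope.

(* A point of R^(2n+1-k) is a row vector split into consecutive blocks
   (v, eta, w, tau) of sizes n-k, k, n-k and 1. *)
Definition hdim (n k : nat) : nat := ((n - k) + k + (n - k))%N.

Fact hdimE (n k : nat) : (k <= n)%N -> hdim n k = (2 * n - k)%N.
Proof. by move=> kn; rewrite /hdim subnK // addnBA // addnn mul2n. Qed.

Notation hpoint R n k := ('rV[R]_(hdim n k + 1)).

Definition hproj (R : realType) (n k : nat) (a : hpoint R n k) :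
  'rV[R]_(hdim n k) := lsubmx a.
Definition vpart (R : realType) (n k : nat) (a : hpoint R n k) : 'rV[R]_(n - k) :=
  lsubmx (lsubmx (hproj a)).
Definition etapart (R : realType) (n k : nat) (a : hpoint R n k) : 'rV[R]_k :=
  rsubmx (lsubmx (hproj a)).
Definition wpart (R : realType) (n k : nat) (a : hpoint R n k) : 'rV[R]_(n - k) :=
  rsubmx (hproj a).
Definition taupart (R : realType) (n k : nat) (a : hpoint R n k) : R :=
  rsubmx a 0 0.

Definition hsigma (R : realType) (n k : nat) (a a' : hpoint R n k) : R :=
  2^-1 * \sum_(j < n - k)
    (vpart a 0 j * wpart a' 0 j - vpart a' 0 j * wpart a 0 j).

Definition gmul (R : realType) (n k : nat) (a a' : hpoint R n k) : hpoint R n k :=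
  row_mx (hproj a + hproj a') (taupart a + taupart a' + hsigma a a')%:M.

Definition ginv (R : realType) (n k : nat) (a : hpoint R n k) : hpoint R n k := - a.

Definition dilation (R : realType) (n k : nat) (l : R) (a : hpoint R n k) :
  hpoint R n k := row_mx (l *: hproj a) (l ^+ 2 * taupart a)%:M.

(* The library norm on 'rV is the sup norm. *)
Definition enorm (R : realType) (m : nat) (x : 'rV[R]_m) : R :=
  Num.sqrt (\sum_(i < m) x 0 i ^+ 2).

Definition open_cube (R : realType) (n k : nat) (a : hpoint R n k) (r : R) :
  set (hpoint R n k) := [set p | forall i, `|p 0 i - a 0 i| < r].

(* A map on an open subset Omega is a total function of which only the values
   on Omega matter: the notions below at a point a0 depend only on the values of
   phi near a0. *)
Definition intrinsic_dist (R : realType) (n k : nat) (phi : hpoint R n k -> 'rV[R]_k)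
    (a a' : hpoint R n k) : R :=
  Num.max (enorm (hproj a - hproj a'))
    (Num.sqrt `|taupart a - taupart a'
      + \sum_(j < k) phi a' 0 j * (etapart a' 0 j - etapart a 0 j)
      + hsigma a a'|).

Definition star_linear (R : realType) (n k : nat)
    (L : hpoint R n k -> 'rV[R]_k) : Prop :=
  (forall a a', L (gmul a a') = L a + L a') /\
  (forall (l : R) a, 0 < l -> L (dilation l a) = l *: L a).

Definition intrinsic_differential (R : realType) (n k : nat)
    (phi : hpoint R n k -> 'rV[R]_k) (a0 : hpoint R n k)
    (L : hpoint R n k -> 'rV[R]_k) : Prop :=
  star_linear L /\
  (enorm (phi a - phi a0 - L (gmul (ginv a0) a)) / intrinsic_dist phi a a0)
    @[a --> a0^'] --> (0 : R).

(* Junk value 0 where phi is not intrinsic differentiable. *)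
Definition intrinsic_jacobian (R : realType) (n k : nat)
    (phi : hpoint R n k -> 'rV[R]_k) (a0 : hpoint R n k) :
    'M[R]_(k, hdim n k) :=
  xget 0 [set M | exists2 L, intrinsic_differential phi a0 L &
                    forall p, (L p)^T = M *m (hproj p)^T].

(* The supremum is taken in the extended reals, as it may be infinite. *)
Definition uniformly_intrinsic_differentiable_at (R : realType) (n k : nat)
    (phi : hpoint R n k -> 'rV[R]_k) (a0 : hpoint R n k) : Prop :=
  exists2 L, star_linear L &
    ereal_sup [set x : \bar R | exists a b : hpoint R n k,
        [/\ open_cube a0 r a, open_cube a0 r b, a != b &
            x = (enorm (phi b - phi a - L (gmul (ginv a) b))
                   / intrinsic_dist phi b a)%:E]]
      @[r --> (0 : R)^'+] --> (0 : \bar R)%E.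

Definition uniformly_intrinsic_differentiable (R : realType) (n k : nat)
    (Omega : set (hpoint R n k)) (phi : hpoint R n k -> 'rV[R]_k) : Prop :=
  forall a0, Omega a0 -> uniformly_intrinsic_differentiable_at phi a0.

Definition C1_on (R : realType) (m p : nat) (Omega : set 'rV[R]_m)
    (f : 'rV[R]_m -> 'rV[R]_p) : Prop :=
  (forall a, Omega a -> differentiable f a) /\
  {within Omega, continuous (jacobian f)}.

Definition compactly_inside (T : topologicalType) (A B : set T) : Prop :=
  compact (closure A) /\ closure A `<=` B.

(* Main.v *)
Require Import Defs.
From HB Require Import structures.
From mathcomp Require Import all_boot all_order all_algebra.
From mathcomp Require Import all_classical all_reals all_analysis.
From mathcomp Require Import ring lra.
Set Implicit Arguments.
Unset Strict Implicit.
Unset Printing Implicit Defensive.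
Import Order.TTheory GRing.Theory Num.Theory.
Import numFieldNormedType.Exports.
Local Open Scope classical_set_scope.
Local Open Scope ring_scope.

(** Write [lift y u p] for the intrinsic vector fields at [p] with slope [y] and
    coefficients [u]. For a differentiable map [psi] the intrinsic Jacobian
    consists of the derivatives of [psi] along these fields with slope [psi p]
    ([intrinsic_jacobian_diff]), and uniform intrinsic differentiability says that
    near each point the intrinsic Taylor error is small, uniformly, with respect
    to the intrinsic distance ([uid_with]).

    Approximation implies differentiability. Let [psi] be a [C^1] map whose
    intrinsic Jacobian is close to a constant matrix on a ball. Along the
    intrinsic fields [psi] is almost affine, and moving horizontally from [a] until
    [b] lies on the same vertical line costs a vertical error of the order of the
    square of the intrinsic distance ([transport]). Along the vertical, [psi] is
    Hoelder of exponent 1/2 with a small constant ([vertical_gap]): two points of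
    a vertical line which move along the [eta_j] field approach or separate with a
    speed equal to the difference of the values of [psi_j], this speed is almost
    constant, and the points never meet. The two facts give the Taylor estimate
    with constants that do not see the regularity of [psi] ([uniform_taylor]), and
    it passes to the limit ([uid_of_approximation]).

    Differentiability implies approximation. The differential is continuous
    ([uid_differential_continuous]), and on a compact set all estimates are
    uniform ([compact_uniform]). Cover the set at scale [h] by intrinsic boxes
    centred at a net with bounded overlap ([net_exists]) and take the mean
    [smooth] of the intrinsic tangent planes of [phi] at the centres, weighted by
    bumps adapted to the boxes. Each bump uses the frame frozen at its centre,
    hence is smooth although [phi] is not, and on its support the tangent plane
    differs from [phi] by [o(h)]. Derivatives of the bumps along the intrinsic
    fields are of order [1 / h]: the slopes of the mean and of the frozen frame differ
    by [O(h)], and a vertical derivative costs [h ^- 2]. Hence the Jacobian of the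
    mean is a mean of nearby values of the differential of [phi] up to [o(1)]
    ([smooth_estimate]). An exhaustion by compact sets turns this into a family
    which is good on every compactly contained open set
    ([approximation_of_uid]). *)

(** * Matrices with the sup norm *)

Section MatrixNorm.
Variable R : realType.

Lemma mx_entryB (V : zmodType) (m p : nat) (A B : 'M[V]_(m, p)) i j :
  (A - B) i j = A i j - B i j.
Proof. by rewrite !mxE. Qed.

Lemma mx_norm_leP (m p : nat) (x : 'M[R]_(m, p)) (e : R) :
  0 <= e -> (`|x| <= e) <-> (forall i j, `|x i j| <= e).
Proof.
move=> e0; rewrite {1}/Num.Def.normr/= mx_normrE; split.
  move=> /bigmax_leP[_ h] i j; exact: (h (i, j)).
by move=> h; apply/bigmax_leP; split.
Qed.

Lemma mx_norm_ltP (m p : nat) (x : 'M[R]_(m, p)) (e : R) :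
  0 < e -> (`|x| < e) <-> (forall i j, `|x i j| < e).
Proof.
move=> e0; rewrite {1}/Num.Def.normr/= mx_normrE; split.
  move=> /bigmax_ltP[_ h] i j; exact: (h (i, j)).
by move=> h; apply/bigmax_ltP; split.
Qed.

Lemma mx_entry_le (m p : nat) (x : 'M[R]_(m, p)) i j : `|x i j| <= `|x|.
Proof. by have /mx_norm_leP := lexx `|x|; apply. Qed.

Lemma mulmx_norm_le (m p q : nat) (x : 'M[R]_(m, p)) (y : 'M[R]_(p, q)) :
  `|x *m y| <= p%:R * `|x| * `|y|.
Proof.
apply/mx_norm_leP; first by rewrite !mulr_ge0.
move=> i j; rewrite mxE (le_trans (ler_norm_sum _ _ _))//.
rewrite -mulrA mulr_natl -[X in _ *+ X]card_ord -sumr_const.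
by apply: ler_sum => l _; rewrite normrM ler_pM // mx_entry_le.
Qed.

Lemma trmx_norm (m p : nat) (x : 'M[R]_(m, p)) : `|x^T| = `|x|.
Proof.
apply/eqP; rewrite eq_le; apply/andP; split; apply/mx_norm_leP => // i j.
  by rewrite mxE mx_entry_le.
by have := mx_entry_le x^T j i; rewrite mxE.
Qed.

Lemma enorm_ge0 (m : nat) (x : 'rV[R]_m) : 0 <= enorm x.
Proof. exact: sqrtr_ge0. Qed.

Lemma enorm0 (m : nat) : enorm (0 : 'rV[R]_m) = 0.
Proof.
by rewrite /enorm big1 ?sqrtr0 // => i _; rewrite mxE expr0n.
Qed.

Lemma norm_le_enorm (m : nat) (x : 'rV[R]_m) : `|x| <= enorm x.
Proof.
apply/mx_norm_leP; first exact: enorm_ge0.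
move=> i j; rewrite (ord1 i) -sqrtr_sqr /enorm ler_wsqrtr //.
rewrite (bigD1 j) //= lerDl sumr_ge0 // => l _; exact: sqr_ge0.
Qed.

Lemma enorm_le_norm (m : nat) (x : 'rV[R]_m) : enorm x <= m%:R * `|x|.
Proof.
rewrite -[leRHS]ger0_norm ?mulr_ge0// -sqrtr_sqr /enorm ler_wsqrtr // exprMn.
apply: (@le_trans _ _ (m%:R * `|x| ^+ 2)).
  rewrite mulr_natl -[X in _ *+ X]card_ord -sumr_const.
  apply: ler_sum => i _; rewrite -real_normK ?num_real//.
  by rewrite ler_pXn2r ?nnegrE // mx_entry_le.
rewrite ler_wpM2r ?sqr_ge0// -natrX ler_nat; case: m {x} => // m.
by rewrite expnS leq_pmulr.
Qed.

Lemma enormZ_delta (m : nat) (c : 'I_m) (t : R) :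
  enorm (t *: (delta_mx 0 c : 'rV[R]_m)) = `|t|.
Proof.
rewrite /enorm (bigD1 c) //= big1 ?addr0.
  by rewrite !mxE !eqxx mulr1 sqrtr_sqr.
by move=> i /negbTE ic; rewrite !mxE ic andbF mulr0 expr0n.
Qed.

Lemma delta_rV_norm (m : nat) (c : 'I_m) : `|(delta_mx 0 c : 'rV[R]_m)| = 1.
Proof.
apply/eqP; rewrite eq_le; apply/andP; split.
  apply/mx_norm_leP => // i j; rewrite !mxE.
  by case: (_ && _); rewrite ?normr1 ?normr0.
by have := mx_entry_le (delta_mx 0 c : 'rV[R]_m) 0 c; rewrite !mxE !eqxx normr1.
Qed.

Lemma row_mx_norm_le (m p : nat) (x : 'rV[R]_m) (y : 'rV[R]_p) (e : R) :
  0 <= e -> `|x| <= e -> `|y| <= e -> `|row_mx x y| <= e.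
Proof.
move=> e0 xe ye; apply/mx_norm_leP => // i j; rewrite mxE.
by case: splitP => l _; rewrite (le_trans (mx_entry_le _ _ _)).
Qed.

Lemma lsubmx_norm_le (m p : nat) (x : 'rV[R]_(m + p)) : `|lsubmx x| <= `|x|.
Proof. by apply/mx_norm_leP => // i j; rewrite mxE mx_entry_le. Qed.

Lemma rsubmx_norm_le (m p : nat) (x : 'rV[R]_(m + p)) : `|rsubmx x| <= `|x|.
Proof. by apply/mx_norm_leP => // i j; rewrite mxE mx_entry_le. Qed.

End MatrixNorm.

(** * The group structure in coordinates *)

Section Group.
Variables (R : realType) (n k : nat).
Local Notation d := (hdim n k).
Implicit Types (u : 'rV[R]_d) (a b p : hpoint R n k).
Implicit Types (phi : hpoint R n k -> 'rV[R]_k).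

Definition eta_of u : 'rV[R]_k := rsubmx (lsubmx u).

Definition sig u u' : R :=
  2^-1 * \sum_(j < n - k) (lsubmx (lsubmx u) 0 j * rsubmx u' 0 j
                           - lsubmx (lsubmx u') 0 j * rsubmx u 0 j).

Lemma hsigmaE a b : hsigma a b = sig (hproj a) (hproj b).
Proof. by []. Qed.

Lemma sigN u u' : sig u' u = - sig u u'.
Proof.
rewrite /sig -[RHS]mulrN -sumrN; congr (_ * _); apply: eq_bigr => j _; ring.
Qed.

Lemma sigDl u v u' : sig (u + v) u' = sig u u' + sig v u'.
Proof.
rewrite /sig -[RHS]mulrDr -big_split; congr (_ * _); apply: eq_bigr => j _.
by rewrite !mxE /=; ring.
Qed.

Lemma sigZl (t : R) u u' : sig (t *: u) u' = t * sig u u'.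
Proof.
rewrite /sig mulrCA [X in _ = _ * X]mulr_sumr; congr (_ * _); apply: eq_bigr => j _.
by rewrite !mxE; ring.
Qed.

Lemma sigBl u v u' : sig (u - v) u' = sig u u' - sig v u'.
Proof. by rewrite sigDl -scaleN1r sigZl mulN1r. Qed.

Lemma sigDr u v u' : sig u' (u + v) = sig u' u + sig u' v.
Proof. by rewrite !(sigN _ u') sigDl opprD. Qed.

Lemma sigZr (t : R) u u' : sig u' (t *: u) = t * sig u' u.
Proof. by rewrite !(sigN _ u') sigZl mulrN. Qed.

Lemma sigBr u v u' : sig u' (u - v) = sig u' u - sig u' v.
Proof. by rewrite sigDr -scaleN1r sigZr mulN1r. Qed.

Lemma sigxx u : sig u u = 0.
Proof. by rewrite /sig big1 ?mulr0 // => j _; rewrite subrr. Qed.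

Lemma sig_le u u' : `|sig u u'| <= n%:R * `|u| * `|u'|.
Proof.
rewrite /sig normrM (ger0_norm (x := 2^-1)) ?invr_ge0//.
apply: (@le_trans _ _ (2^-1 * ((n - k)%:R * (2 * (`|u| * `|u'|))))).
  rewrite ler_wpM2l ?invr_ge0// (le_trans (ler_norm_sum _ _ _))//.
  rewrite [leRHS]mulr_natl -[X in _ *+ X]card_ord -sumr_const.
  apply: ler_sum => j _; rewrite (le_trans (ler_normB _ _))// mulr_natl mulr2n.
  rewrite !normrM (mulrC `|lsubmx (lsubmx u') 0 j|).
  by apply: lerD; apply: ler_pM => //; rewrite ?mxE mx_entry_le.
rewrite mulrCA (mulrA 2^-1) mulVf ?mul1r ?pnatr_eq0// mulrA.
by rewrite ler_wpM2r// ler_wpM2r// ler_nat leq_subr.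
Qed.

Lemma eta_of_norm u : `|eta_of u| <= `|u|.
Proof. exact: le_trans (rsubmx_norm_le _) (lsubmx_norm_le _). Qed.

Lemma eta_ofD u v : eta_of (u + v) = eta_of u + eta_of v.
Proof. by apply/rowP => j; rewrite !mxE. Qed.
Lemma eta_ofZ (t : R) u : eta_of (t *: u) = t *: eta_of u.
Proof. by apply/rowP => j; rewrite !mxE. Qed.
Lemma eta_ofB u v : eta_of (u - v) = eta_of u - eta_of v.
Proof. by apply/rowP => j; rewrite !mxE. Qed.

Definition pair (x y : 'rV[R]_k) : R := \sum_(j < k) x 0 j * y 0 j.

Lemma pairDl x y z : pair (x + y) z = pair x z + pair y z.
Proof. by rewrite /pair -big_split; apply: eq_bigr => j _; rewrite mxE /= mulrDl. Qed.
Lemma pairDr x y z : pair z (x + y) = pair z x + pair z y.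
Proof. by rewrite /pair -big_split; apply: eq_bigr => j _; rewrite mxE /= mulrDr. Qed.
Lemma pairZl (t : R) x z : pair (t *: x) z = t * pair x z.
Proof. by rewrite /pair mulr_sumr; apply: eq_bigr => j _; rewrite mxE mulrA. Qed.
Lemma pairZr (t : R) x z : pair z (t *: x) = t * pair z x.
Proof. by rewrite /pair mulr_sumr; apply: eq_bigr => j _; rewrite mxE mulrCA. Qed.
Lemma pairBl x y z : pair (x - y) z = pair x z - pair y z.
Proof. by rewrite pairDl -scaleN1r pairZl mulN1r. Qed.
Lemma pairBr x y z : pair z (x - y) = pair z x - pair z y.
Proof. by rewrite pairDr -scaleN1r pairZr mulN1r. Qed.

Lemma pair_le x y : `|pair x y| <= k%:R * `|x| * `|y|.
Proof.
rewrite /pair (le_trans (ler_norm_sum _ _ _))//.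
rewrite -mulrA mulr_natl -[X in _ *+ X]card_ord -sumr_const.
by apply: ler_sum => l _; rewrite normrM ler_pM // mx_entry_le.
Qed.

(** The height of [a] above the plane through [a'] spanned by the intrinsic
    vector fields with slope [y]. For [y = phi a'] its absolute value stands under
    the square root in the intrinsic distance; the slope is kept as a separate
    argument because frames frozen at different points get compared. *)
Definition vdefect (y : 'rV[R]_k) a a' : R :=
  taupart a - taupart a' - pair y (eta_of (hproj a - hproj a'))
  + sig (hproj a) (hproj a').

Lemma intrinsic_distE phi a a' : intrinsic_dist phi a a' =
  Num.max (enorm (hproj a - hproj a')) (Num.sqrt `|vdefect (phi a') a a'|).
Proof.
rewrite /intrinsic_dist /vdefect hsigmaE; do 4 congr (_ _); congr (_ + _ + _).
rewrite eta_ofB /pair -sumrN; apply: eq_bigr => j _.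
by rewrite -mulrN !mxE opprB.
Qed.

Lemma hprojB a b : hproj (a - b) = hproj a - hproj b.
Proof. by apply/rowP => j; rewrite !mxE. Qed.
Lemma hprojD a b : hproj (a + b) = hproj a + hproj b.
Proof. by apply/rowP => j; rewrite !mxE. Qed.
Lemma hprojZ (t : R) b : hproj (t *: b) = t *: hproj b.
Proof. by apply/rowP => j; rewrite !mxE. Qed.
Lemma taupartB a b : taupart (a - b) = taupart a - taupart b.
Proof. by rewrite /taupart !mxE. Qed.
Lemma taupartD a b : taupart (a + b) = taupart a + taupart b.
Proof. by rewrite /taupart !mxE. Qed.
Lemma taupartZ (t : R) b : taupart (t *: b) = t * taupart b.
Proof. by rewrite /taupart !mxE. Qed.

Definition mkpt u (t : R) : hpoint R n k := row_mx u t%:M.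

Lemma hproj_mkpt u t : hproj (mkpt u t) = u.
Proof. by rewrite /hproj row_mxKl. Qed.
Lemma taupart_mkpt u t : taupart (mkpt u t) = t.
Proof. by rewrite /taupart row_mxKr mxE eqxx. Qed.
Lemma mkptK a : mkpt (hproj a) (taupart a) = a.
Proof.
rewrite /mkpt -[RHS]hsubmxK; congr row_mx.
by apply/rowP => j; rewrite (ord1 j) [LHS]mxE eqxx.
Qed.
Lemma hpoint_eq a b : hproj a = hproj b -> taupart a = taupart b -> a = b.
Proof. by move=> h t; rewrite -(mkptK a) -(mkptK b) h t. Qed.
Lemma mkptD u v t s : mkpt u t + mkpt v s = mkpt (u + v) (t + s).
Proof.
by apply: hpoint_eq; rewrite ?hprojD ?taupartD ?hproj_mkpt ?taupart_mkpt.
Qed.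
Lemma mkptZ u t s : s *: mkpt u t = mkpt (s *: u) (s * t).
Proof.
by apply: hpoint_eq; rewrite ?hprojZ ?taupartZ ?hproj_mkpt ?taupart_mkpt.
Qed.

Lemma hproj_norm a : `|hproj a| <= `|a|. Proof. exact: lsubmx_norm_le. Qed.
Lemma taupart_norm a : `|taupart a| <= `|a|.
Proof. by rewrite (le_trans (mx_entry_le _ _ _))// rsubmx_norm_le. Qed.
Lemma hpoint_norm_le a (e : R) : `|hproj a| <= e -> `|taupart a| <= e -> `|a| <= e.
Proof.
move=> h t; rewrite -(mkptK a); have e0 : 0 <= e by rewrite (le_trans _ h).
apply: row_mx_norm_le => //; apply/mx_norm_leP => // i j.
by rewrite (ord1 i) (ord1 j) mxE eqxx.
Qed.
Lemma hpoint_norm_lt a (e : R) : `|hproj a| < e -> `|taupart a| < e -> `|a| < e.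
Proof.
move=> h t; apply: (@le_lt_trans _ _ (Num.max `|hproj a| `|taupart a|)).
  by apply: hpoint_norm_le; rewrite le_max lexx ?orbT.
by rewrite gt_max h.
Qed.

Lemma open_cubeE a (r : R) : 0 < r -> open_cube a r = [set p | `|p - a| < r].
Proof.
move=> r0; apply/seteqP; split => p /=.
  by move=> h; apply/mx_norm_ltP => // i j; rewrite (ord1 i) !mxE; apply: h.
by move=> /(mx_norm_ltP _ r0) h i; have := h 0 i; rewrite !mxE.
Qed.

Lemma hproj_gmul a b : hproj (gmul a b) = hproj a + hproj b.
Proof. by rewrite /gmul hproj_mkpt. Qed.
Lemma hproj_ginv_gmul a b : hproj (gmul (ginv a) b) = hproj b - hproj a.
Proof. by rewrite hproj_gmul /ginv -scaleN1r hprojZ scaleN1r addrC. Qed.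

(** The centre is killed because it scales quadratically under dilations
    while the target scales linearly: doubling [t] twice by additivity and once by
    the dilation of factor 2 gives [4 *: L t = 2 *: L t]. *)
Lemma star_linear_matrix (L : hpoint R n k -> 'rV[R]_k) : star_linear L ->
  exists M : 'M[R]_(k, d), forall p, L p = hproj p *m M^T.
Proof.
case=> Lmul Ldil.
have vert t : L (mkpt 0 t) = 0.
  have sg0 s t' : gmul (mkpt 0 s) (mkpt 0 t') = mkpt 0 (s + t').
    rewrite /gmul hsigmaE !hproj_mkpt !taupart_mkpt addr0 -[in sig _ _](scale0r 0).
    by rewrite sigZl mul0r addr0.
  have h1 : L (mkpt 0 (2 ^+ 2 * t)) = 2 *: L (mkpt 0 t).
    have -> : mkpt 0 (2 ^+ 2 * t) = dilation 2 (mkpt 0 t).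
      by rewrite /dilation hproj_mkpt taupart_mkpt scaler0.
    by rewrite Ldil.
  have h2 : L (mkpt 0 (2 ^+ 2 * t)) = 4 *: L (mkpt 0 t).
    have -> : 2 ^+ 2 * t = (t + t) + (t + t) by ring.
    by rewrite -!sg0 !Lmul -mulr2n -mulr2n -mulrnA scaler_nat.
  have /eqP : (4 - 2) *: L (mkpt 0 t) = 0 by rewrite scalerBl -h1 -h2 subrr.
  rewrite scaler_eq0 => /orP[|/eqP//].
  have -> : (4 - 2 : R) = 2 by ring.
  by rewrite pnatr_eq0.
pose l u := L (mkpt u 0).
have LE p : L p = l (hproj p).
  have -> : p = gmul (mkpt (hproj p) 0) (mkpt 0 (taupart p)).
    rewrite /gmul hsigmaE !hproj_mkpt !taupart_mkpt addr0 add0r.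
    rewrite -[in sig _ _](scale0r 0) sigZr mul0r addr0; exact: esym (mkptK p).
  by rewrite Lmul vert addr0 hproj_gmul !hproj_mkpt addr0.
have lD u v : l (u + v) = l u + l v.
  by rewrite -[u in LHS](hproj_mkpt u 0) -[v in LHS](hproj_mkpt v 0) -hproj_gmul -LE Lmul.
have l0 : l 0 = 0 by rewrite /l vert.
have lN u : l (- u) = - l u.
  by apply/eqP; rewrite -subr_eq0 opprK -lD addNr l0.
have lpos t u : 0 < t -> l (t *: u) = t *: l u.
  move=> t0; rewrite /l -Ldil//; congr L.
  by rewrite /dilation hproj_mkpt taupart_mkpt mulr0.
have lZ t u : l (t *: u) = t *: l u.
  case: (ltrgtP t 0) => [t0|t0|->]; last by rewrite !scale0r l0.
    rewrite -[in LHS](opprK t) scaleNr lN lpos ?oppr_gt0// scaleNr opprK//.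
  exact: lpos.
exists (\matrix_(i, j) l (delta_mx 0 j) 0 i) => p; rewrite LE.
rewrite [in LHS](row_sum_delta (hproj p)).
have -> : l (\sum_(j < d) hproj p 0 j *: delta_mx 0 j) =
          \sum_(j < d) hproj p 0 j *: l (delta_mx 0 j).
  rewrite (big_morph l lD l0); apply: eq_bigr => j _; exact: lZ.
apply/rowP => i; rewrite summxE [RHS]mxE; apply: eq_bigr => j _.
by rewrite !mxE.
Qed.

Lemma matrix_star_linear (M : 'M[R]_(k, d)) :
  star_linear (fun p : hpoint R n k => hproj p *m M^T).
Proof.
split=> [a a'|t a _]; first by rewrite hproj_gmul mulmxDl.
by rewrite /dilation hproj_mkpt -scalemxAl.
Qed.

Lemma star_matrixP (L : hpoint R n k -> 'rV[R]_k) (M : 'M[R]_(k, d)) p :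
  (L p)^T = M *m (hproj p)^T <-> L p = hproj p *m M^T.
Proof. by split=> [/(congr1 trmx)|->]; rewrite ?trmx_mul ?trmxK// trmx_mul trmxK. Qed.

(** The intrinsic vector fields, combined with the constant coefficients [u] and
    evaluated at [p] with slope [y]. Because [sig u u = 0], their straight
    segments are horizontal curves: moving by [lift y u p] from [p] leaves
    [vdefect y] at zero. *)
Definition lift (y : 'rV[R]_k) u p : hpoint R n k :=
  mkpt u (pair y (eta_of u) - sig u (hproj p)).

Lemma hproj_lift y u p : hproj (lift y u p) = u.
Proof. exact: hproj_mkpt. Qed.
Lemma taupart_lift y u p :
  taupart (lift y u p) = pair y (eta_of u) - sig u (hproj p).
Proof. exact: taupart_mkpt. Qed.

Lemma liftD (y : 'rV[R]_k) u v p : lift y (u + v) p = lift y u p + lift y v p.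
Proof. by rewrite /lift mkptD eta_ofD pairDr sigDl; congr mkpt; ring. Qed.

Lemma liftZ y (t : R) u p : lift y (t *: u) p = t *: lift y u p.
Proof. by rewrite /lift mkptZ eta_ofZ pairZr sigZl mulrBr. Qed.

Lemma decomp_lift y a a' :
  a - a' = lift y (hproj a - hproj a') a' + mkpt 0 (vdefect y a a').
Proof.
apply: hpoint_eq.
  by rewrite hprojB hprojD hproj_lift hproj_mkpt addr0.
rewrite taupartB taupartD taupart_lift taupart_mkpt /vdefect.
by rewrite sigBl sigxx subr0; ring.
Qed.

Lemma vdefect_lift y u p : vdefect y (p + lift y u p) p = 0.
Proof.
rewrite /vdefect taupartD hprojD taupart_lift hproj_lift.
have -> : hproj p + u - hproj p = u by rewrite addrC addKr.
by rewrite sigDl sigxx; ring.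
Qed.

Lemma lift_norm y u p :
  `|lift y u p| <= `|u| * (1 + k%:R * `|y| + n%:R * `|hproj p|).
Proof.
have h1 : 0 <= `|u| * (k%:R * `|y|) by rewrite !mulr_ge0.
have h2 : 0 <= `|u| * (n%:R * `|hproj p|) by rewrite !mulr_ge0.
apply: hpoint_norm_le; rewrite ?hproj_lift ?taupart_lift.
  by rewrite 2!mulrDr mulr1 -addrA lerDl addr_ge0.
rewrite (le_trans (ler_normB _ _))//.
have e1 : `|pair y (eta_of u)| <= `|u| * (k%:R * `|y|).
  rewrite (le_trans (pair_le _ _))// mulrC ler_wpM2r ?mulr_ge0// eta_of_norm//.
have e2 : `|sig u (hproj p)| <= `|u| * (n%:R * `|hproj p|).
  by rewrite (le_trans (sig_le _ _))// [leRHS]mulrCA mulrA.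
rewrite 2!mulrDr mulr1 -addrA (le_trans (lerD e1 e2))//.
by rewrite lerDr.
Qed.

Lemma enorm_le_dist phi a a' : enorm (hproj a - hproj a') <= intrinsic_dist phi a a'.
Proof. by rewrite intrinsic_distE le_max lexx. Qed.

Lemma norm_le_dist phi a a' : `|hproj a - hproj a'| <= intrinsic_dist phi a a'.
Proof. exact: le_trans (norm_le_enorm _) (enorm_le_dist _ _ _). Qed.

Lemma intrinsic_dist_ge0 phi a a' : 0 <= intrinsic_dist phi a a'.
Proof. by rewrite (le_trans (enorm_ge0 _) (enorm_le_dist phi a a')). Qed.

Lemma vdefect_le_dist phi a a' :
  `|vdefect (phi a') a a'| <= intrinsic_dist phi a a' ^+ 2.
Proof.
rewrite -[leLHS]sqr_sqrtr// ler_pXn2r ?nnegrE ?intrinsic_dist_ge0 ?sqrtr_ge0//.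
by rewrite intrinsic_distE le_max lexx orbT.
Qed.

Lemma intrinsic_distxx phi a : intrinsic_dist phi a a = 0.
Proof.
rewrite intrinsic_distE subrr enorm0 /vdefect !subrr sigxx addr0.
rewrite -[0 : 'rV_d](scale0r 0) eta_ofZ pairZr mul0r subr0 normr0 sqrtr0.
exact: maxxx.
Qed.

Lemma intrinsic_dist_gt0 phi a a' : a != a' -> 0 < intrinsic_dist phi a a'.
Proof.
move=> aa'; rewrite lt_neqAle intrinsic_dist_ge0 andbT; apply: contraNN aa'.
move=> /eqP h0; have := norm_le_dist phi a a'; rewrite -h0 normr_le0 subr_eq0.
move=> /eqP e1; have := vdefect_le_dist phi a a'; rewrite -h0 expr0n /= normr_le0.
move=> /eqP e2; rewrite -subr_eq0 (decomp_lift (phi a')) e2 e1 subrr.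
rewrite -[X in lift _ X _](scale0r 0) liftZ scale0r add0r.
by rewrite -[X in mkpt X](scale0r 0) -[X in mkpt _ X](mul0r 0) -mkptZ scale0r.
Qed.

Lemma intrinsic_dist_lift phi u p :
  intrinsic_dist phi (p + lift (phi p) u p) p = enorm u.
Proof.
rewrite intrinsic_distE vdefect_lift normr0 sqrtr0 hprojD hproj_lift.
have -> : hproj p + u - hproj p = u by rewrite addrC addKr.
by apply/max_idPl; exact: enorm_ge0.
Qed.

End Group.

(** * Uniform intrinsic differentiability without suprema *)

Section Differentiability.
Variables (R : realType) (n k : nat).
Local Notation d := (hdim n k).
Local Notation pt := (hpoint R n k).
Implicit Types (u : 'rV[R]_d) (a b p : pt).
Implicit Types (phi : pt -> 'rV[R]_k).

Definition taylor_err phi (M : 'M[R]_(k, d)) a b : 'rV[R]_k :=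
  phi b - phi a - (hproj b - hproj a) *m M^T.

(** Differentiability with a prescribed matrix and the sup norm: the Euclidean
    norm of the target is equivalent to it, and the pairs [a = b], which the
    supremum leaves out, satisfy the inequality trivially. *)
Definition uid_with phi (M : 'M[R]_(k, d)) a0 : Prop :=
  forall e : R, 0 < e -> exists2 r : R, 0 < r & forall a b,
    `|a - a0| < r -> `|b - a0| < r ->
    `|taylor_err phi M a b| <= e * intrinsic_dist phi b a.

Lemma taylor_errxx phi M a : taylor_err phi M a a = 0.
Proof. by rewrite /taylor_err !subrr mul0mx subrr. Qed.

Lemma uid_at_with phi a0 : uniformly_intrinsic_differentiable_at phi a0 ->
  exists M, uid_with phi M a0.
Proof.
case=> L /star_linear_matrix[M LM] cv; exists M => e e0.
have /= := cv _ (open_ereal_lt' (x := 0%E) (y := e%:E) e0).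
rewrite /nbhs/= /nbhs/= => -[r r0 hr]; exists (r / 2); first exact: divr_gt0.
move=> a b ar br; have [->|ab] := eqVneq b a.
  by rewrite taylor_errxx normr0 intrinsic_distxx mulr0.
have r2 : 0 < r / 2 by rewrite divr_gt0.
have rr2 : ball_ Num.Def.normr (0 : R) r (r / 2).
  by rewrite /= sub0r normrN gtr0_norm// ltr_pdivrMr// ltr_pMr// ltr1n.
have hs := hr _ rr2 r2.
have : ((enorm (phi b - phi a - L (gmul (ginv a) b))
         / intrinsic_dist phi b a)%:E < e%:E)%E.
  apply: le_lt_trans hs; apply: ereal_sup_ubound; exists a, b.
  by split; rewrite ?open_cubeE ?divr_gt0// eq_sym.
rewrite lte_fin ltr_pdivrMr ?intrinsic_dist_gt0// LM hproj_ginv_gmul.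
by move=> h; apply: le_trans (ltW h); exact: norm_le_enorm.
Qed.

Lemma uid_with_at phi M a0 : uid_with phi M a0 ->
  uniformly_intrinsic_differentiable_at phi a0.
Proof.
move=> H; exists (fun p : pt => hproj p *m M^T); first exact: matrix_star_linear.
set S := fun r : R => _; rewrite -/(S @ 0^'+).
have key e : 0 < e -> \forall r \near 0^'+, (0 <= S r)%E /\ (S r <= e%:E)%E.
  move=> e0; have e1 : 0 < e / (k%:R + 1) by rewrite divr_gt0// ltr_wpDl.
  have [r0 r0_gt0 hr0] := H _ e1.
  near=> r; have r_gt0 : 0 < r by near: r; exact: nbhs_right_gt.
  have rr0 : r < r0 by near: r; exact: nbhs_right_lt.
  split; last first.
    apply: ge_ereal_sup => x [a [b []]]; rewrite open_cubeE//= => ar br ab ->.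
    rewrite lee_fin ler_pdivrMr ?intrinsic_dist_gt0 1?eq_sym// hproj_ginv_gmul.
    rewrite (le_trans (enorm_le_norm _))//.
    have := hr0 a b (lt_trans ar rr0) (lt_trans br rr0).
    rewrite /taylor_err mulrAC ler_pdivlMr ?ltr_wpDl// => h.
    by rewrite (le_trans _ h)// mulrC ler_wpM2l// lerDl.
  (* A vertical translate provides an admissible pair, so that the supremum is
     not that of the empty set, which would be minus infinity. *)
  pose b : pt := a0 + mkpt 0 (r / 2).
  have nb : `|b - a0| < r.
    rewrite addrC addKr; apply: hpoint_norm_lt.
      by rewrite hproj_mkpt normr0.
    by rewrite taupart_mkpt gtr0_norm ?divr_gt0// ltr_pdivrMr// ltr_pMr// ltr1n.
  apply: (@le_trans _ _ (enorm (phi b - phi a0 - hproj (gmul (ginv a0) b) *m M^T)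
         / intrinsic_dist phi b a0)%:E).
    by rewrite lee_fin divr_ge0 ?enorm_ge0 ?intrinsic_dist_ge0.
  apply: ereal_sup_ubound; exists a0, b; split => //.
  - by rewrite open_cubeE//= subrr normr0.
  - by rewrite open_cubeE.
  - rewrite eq_sym -subr_eq0 addrC addKr; apply/eqP => /(congr1 (@taupart R n k)).
    rewrite taupart_mkpt /taupart !mxE => /eqP.
    by rewrite mulf_eq0 invr_eq0 pnatr_eq0 orbF gt_eqF.
have fin e r : ((0 <= S r) /\ (S r <= e%:E))%E -> S r \is a fin_num.
  by case=> ? h; rewrite ge0_fin_numE// (le_lt_trans h)// ltry.
apply/fine_cvgP; split.
  by apply: filterS (key 1 ltr01) => r; exact: fin.
apply/cvgr0Pnorm_le => e e0; apply: filterS (key e e0) => r h /=.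
have f := fin _ _ h; case: h => h1 h2.
by rewrite ger0_norm ?fine_ge0// -lee_fin fineK.
Unshelve. all: by end_near. Qed.

(** Moving along [lift] realises every horizontal displacement at intrinsic
    distance equal to its length, so the two linear maps can be compared on each
    coordinate vector. With [e] and [e'] arbitrary this is the uniqueness of the
    intrinsic differential; with fixed [e] and [e'] at a moving base point it is
    what makes the differential continuous. *)
Lemma differential_close phi (M M' : 'M[R]_(k, d)) p (e e' : R) :
  0 <= e + e' ->
  (\forall b \near p, `|taylor_err phi M p b| <= e * intrinsic_dist phi b p) ->
  (\forall b \near p, `|taylor_err phi M' p b| <= e' * intrinsic_dist phi b p) ->
  `|M - M'| <= e + e'.
Proof.
move=> ee H H'; have [r /= r0 hr] := iffLR (nbhs_normP _ _) (filterI H H').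
have key (c : 'I_d) : exists2 t : R, 0 < t &
    forall s, 0 < s -> s <= t ->
      `|s *: (delta_mx 0 c : 'rV_d) *m (M - M')^T| <= (e + e') * s.
  pose C : R := 1 + k%:R * `|phi p| + n%:R * `|hproj p|.
  have C0 : 0 < C by rewrite ltr_wpDr ?mulr_ge0// ltr_wpDr ?mulr_ge0.
  exists (r / C / 2) => [|s s0 st]; first by rewrite !divr_gt0.
  set u := s *: _; pose b := p + lift (phi p) u p.
  have ub : intrinsic_dist phi b p = s.
    by rewrite intrinsic_dist_lift enormZ_delta gtr0_norm.
  have [|h h'] := hr b.
    rewrite /= distrC /b [p + _]addrC addrK (le_lt_trans (lift_norm _ _ _))//.
    rewrite -/C normrZ gtr0_norm// delta_rV_norm mulr1 (le_lt_trans (ler_wpM2r (ltW C0) st))//.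
    by rewrite mulrAC divfK ?gt_eqF// ltr_pdivrMr// ltr_pMr// ltr1n.
  rewrite linearB/= mulmxBr.
  have -> : u *m M^T - u *m M'^T = taylor_err phi M' p b - taylor_err phi M p b.
    rewrite /taylor_err hprojD hproj_lift.
    have -> : hproj p + u - hproj p = u by rewrite addrC addKr.
    by rewrite opprB [RHS]addrC subrKA.
  rewrite (le_trans (ler_normB _ _))// addrC mulrDl -ub; exact: lerD.
apply/mx_norm_leP => // i c; have [t t0 ht] := key c.
  have := mx_entry_le (t *: (delta_mx 0 c : 'rV_d) *m (M - M')^T) 0 i.
  rewrite -scalemxAl -rowE [X in `|X|]mxE [X in `|_ * X|]mxE [X in `|_ * X|]mxE.
  rewrite normrM gtr0_norm// => h.
  have := le_trans h (le_trans _ (ht t t0 (lexx t))).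
  rewrite -scalemxAl -rowE => /(_ (lexx _)).
  by rewrite mulrC ler_pM2r.
Qed.

End Differentiability.

(** * The intrinsic Jacobian of a differentiable map *)

Section Jacobian.
Variables (R : realType) (n k : nat).
Local Notation d := (hdim n k).
Local Notation pt := (hpoint R n k).
Implicit Types (u : 'rV[R]_d) (a b p : pt).
Implicit Types (phi f : pt -> 'rV[R]_k).

Lemma differentiable_near (V W : normedModType R) (f : V -> W) (x : V) (e : R) :
  differentiable f x -> 0 < e ->
  \forall y \near x, `|f y - f x - 'd f x (y - x)| <= e * `|y - x|.
Proof.
move=> df e0; have /eqaddoP/= /(_ e e0) := diff_locally df.
rewrite near_simpl (near_shift x 0) => h; near=> y.
have : `|(f \o shift x - (cst (f x) + 'd f x)) (y - x)| <= e * `|y - x|.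
  by rewrite -(sub0r x); near: y.
have -> : (f \o shift x - (cst (f x) + 'd f x)) (y - x) =
  f (y - x + x) - (f x + 'd f x (y - x)) by [].
by rewrite /= subrK opprD addrA.
Unshelve. all: by end_near. Qed.

Lemma intrinsic_dist_small phi p (e : R) : 0 < e ->
  \forall b \near p, intrinsic_dist phi b p <= e.
Proof.
move=> e0.
pose C : R := 1 + k%:R * `|phi p| + n%:R * `|hproj p|.
have C1 : 1 <= C by rewrite /C -addrA lerDl addr_ge0// mulr_ge0.
have C0 : 0 < C by rewrite (lt_le_trans ltr01).
have vd b : `|vdefect (phi p) b p| <= (1 + C) * `|b - p|.
  have -> : vdefect (phi p) b p = taupart (b - p - lift (phi p) (hproj b - hproj p) p).
    by rewrite [X in _ = taupart (X - _)](decomp_lift (phi p) b p) addrC addKr taupart_mkpt.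
  rewrite (le_trans (taupart_norm _))// (le_trans (ler_normB _ _))//.
  rewrite mulrDl mul1r lerD2l (le_trans (lift_norm _ _ _))// -/C mulrC.
  by rewrite ler_wpM2l ?(ltW C0)// -hprojB hproj_norm.
near=> b.
have h1 : `|b - p| <= e / (d%:R + 1).
  by near: b; apply: cvgr_distC_le => //; rewrite divr_gt0// ltr_wpDl.
have h2 : `|b - p| <= e ^+ 2 / (1 + C).
  near: b; apply: cvgr_distC_le => //; rewrite divr_gt0// ?exprn_gt0//.
  by rewrite addr_gt0.
rewrite intrinsic_distE ge_max; apply/andP; split.
  rewrite (le_trans (enorm_le_norm _))// -hprojB.
  rewrite (le_trans (ler_wpM2l _ (hproj_norm _)))//.
  rewrite (le_trans (ler_wpM2l _ h1))// mulrCA ger_pMr//.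
  by rewrite ler_pdivrMr ?ltr_wpDl// mul1r lerDl.
rewrite -[leRHS](ger0_norm (ltW e0)) -[leRHS]sqrtr_sqr ler_wsqrtr//.
rewrite (le_trans (vd b))// (le_trans (ler_wpM2l _ h2))//.
  by rewrite addr_ge0// ltW.
by rewrite mulrCA divff ?mulr1// gt_eqF// addr_gt0.
Unshelve. all: by end_near. Qed.

Definition jac_matrix f p : 'M[R]_(k, d) :=
  \matrix_(i, j) ('d f p (lift (f p) (delta_mx 0 j) p) : 'rV_k) 0 i.

Lemma jac_matrixE f p u :
  u *m (jac_matrix f p)^T = 'd f p (lift (f p) u p).
Proof.
pose l v : 'rV_k := 'd f p (lift (f p) v p); rewrite -/(l u).
have lD v w : l (v + w) = l v + l w by rewrite /l liftD linearD.
have lZ t v : l (t *: v) = t *: l v by rewrite /l liftZ linearZ.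
have l0 : l 0 = 0 by rewrite -(scale0r (0 : 'rV[R]_d)) lZ scale0r.
rewrite [in RHS](row_sum_delta u) (big_morph l lD l0).
apply/rowP => i; rewrite summxE mxE; apply: eq_bigr => j _.
by rewrite lZ !mxE.
Qed.

(** The increment of [f] splits into an increment along [lift], which is linear
    in the horizontal displacement, and a vertical one, which is quadratic in
    the intrinsic distance and therefore negligible. *)
Lemma taylor_err_jac_matrix f p (e : R) : differentiable f p -> 0 < e ->
  \forall b \near p,
    `|taylor_err f (jac_matrix f p) p b| <= e * intrinsic_dist f b p.
Proof.
move=> df e0.
have [C C0 dC] := linear_lipschitz (diff_continuous df).
pose D : R := 1 + k%:R * `|f p| + n%:R * `|hproj p|.
have D0 : 0 < D by rewrite ltr_wpDr ?mulr_ge0// ltr_wpDr ?mulr_ge0.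
have e1 : 0 < e / 2 / (D + 1) by rewrite !divr_gt0// addr_gt0.
have e2 : 0 < Num.min 1 (e / 2 / C) by rewrite lt_min ltr01 !divr_gt0.
near=> b.
have h : `|f b - f p - 'd f p (b - p)| <= e / 2 / (D + 1) * `|b - p|.
  by near: b; exact: (differentiable_near df e1).
have : intrinsic_dist f b p <= Num.min 1 (e / 2 / C).
  by near: b; exact: intrinsic_dist_small.
set r := intrinsic_dist f b p; rewrite le_min => /andP[r1 rC].
have r0 : 0 <= r by exact: intrinsic_dist_ge0.
have vd : `|mkpt 0 (vdefect (f p) b p) : pt| <= r ^+ 2.
  apply: hpoint_norm_le; rewrite ?hproj_mkpt ?normr0 ?sqr_ge0// taupart_mkpt.
  exact: vdefect_le_dist.
have bp : `|b - p| <= (D + 1) * r.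
  rewrite (decomp_lift (f p) b p) (le_trans (ler_normD _ _))// mulrDl mul1r lerD//.
    by rewrite (le_trans (lift_norm _ _ _))// mulrC ler_wpM2l ?(ltW D0)// norm_le_dist.
  by rewrite (le_trans vd)// expr2 ler_piMl.
have -> : taylor_err f (jac_matrix f p) p b =
  (f b - f p - 'd f p (b - p)) + 'd f p (mkpt 0 (vdefect (f p) b p)).
  rewrite /taylor_err jac_matrixE [X in _ = _ - 'd f p X + _](decomp_lift (f p) b p).
  by rewrite linearD /= opprD addrA subrK.
rewrite (le_trans (ler_normD _ _))// [e]splitr mulrDl lerD//.
  rewrite (le_trans h)// (le_trans (ler_wpM2l (ltW e1) bp))//.
  by rewrite mulrA divfK// gt_eqF// addr_gt0.
rewrite (le_trans (dC _))// (le_trans (ler_wpM2l (ltW C0) vd))//.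
rewrite expr2 mulrA ler_wpM2r// mulrC -ler_pdivlMr//.
Unshelve. all: by end_near. Qed.

Lemma taylor_err_intrinsic_differential f p (M : 'M[R]_(k, d)) L :
  intrinsic_differential f p L -> (forall q, L q = hproj q *m M^T) ->
  forall e : R, 0 < e -> \forall b \near p,
    `|taylor_err f M p b| <= e * intrinsic_dist f b p.
Proof.
move=> [_ cv] LM e e0; move/cvgr0Pnorm_le : cv => /(_ e e0).
rewrite near_withinE; apply: filterS => b; have [->|bp] := eqVneq b p.
  by move=> _; rewrite taylor_errxx normr0 intrinsic_distxx mulr0.
move=> /(_ isT); rewrite LM hproj_ginv_gmul normrM normfV.
rewrite !ger0_norm ?enorm_ge0 ?intrinsic_dist_ge0// ler_pdivrMr ?intrinsic_dist_gt0//.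
by apply: le_trans; exact: norm_le_enorm.
Qed.

(** The choice made in [intrinsic_jacobian] is forced: the derivatives along
    the intrinsic fields give one intrinsic differential, and by
    [differential_close] there is no other. *)
Lemma intrinsic_jacobianE f p : differentiable f p ->
  intrinsic_jacobian f p = jac_matrix f p.
Proof.
move=> df; rewrite /intrinsic_jacobian; set S := [set M | _].
have SJ : S (jac_matrix f p).
  exists (fun q : pt => hproj q *m (jac_matrix f p)^T); last first.
    by move=> q; apply/(star_matrixP (fun q : pt => hproj q *m (jac_matrix f p)^T)).
  split; first exact: matrix_star_linear.
  apply/cvgr0Pnorm_le => e e0.
  have e1 : 0 < e / (k%:R + 1) by rewrite divr_gt0// ltr_wpDl.
  apply: nbhs_dnbhs; apply: filterS (taylor_err_jac_matrix df e1) => b.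
  rewrite /taylor_err hproj_ginv_gmul => h.
  rewrite normrM normfV !ger0_norm ?enorm_ge0 ?intrinsic_dist_ge0//.
  have [->|bp] := eqVneq b p.
    by rewrite !subrr mul0mx subrr enorm0 mul0r ltW.
  rewrite ler_pdivrMr ?intrinsic_dist_gt0// (le_trans (enorm_le_norm _))//.
  move: h; rewrite mulrAC ler_pdivlMr ?ltr_wpDl// => h.
  by rewrite (le_trans _ h)// mulrC ler_wpM2l// lerDl.
have [L LD /= LM] := xgetPex 0 (ex_intro _ _ SJ).
apply/eqP; rewrite -subr_eq0 -normr_le0; apply/ler_addgt0Pr => e e0; rewrite add0r.
have e2 : 0 < e / 2 by rewrite divr_gt0.
rewrite [e]splitr; apply: (@differential_close _ _ _ f _ _ p).
- by rewrite addr_ge0// ltW.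
- by apply: taylor_err_intrinsic_differential LD _ _ e2 => q; exact/star_matrixP.
- exact: taylor_err_jac_matrix.
Qed.

Lemma intrinsic_jacobian_diff f p u : differentiable f p ->
  u *m (intrinsic_jacobian f p)^T = 'd f p (lift (f p) u p).
Proof. by move=> df; rewrite intrinsic_jacobianE// jac_matrixE. Qed.

End Jacobian.

(** * Euler polygons along the intrinsic vector fields *)

Lemma mean_value_segment (R : realType) (V : normedModType R) (m : nat)
    (f : V -> 'rV[R]_m) (p v : V) (i : 'I_m) :
  (forall t : R, 0 <= t <= 1 -> differentiable f (p + t *: v)) ->
  exists2 c : R, 0 <= c <= 1 & (f (p + v) - f p) 0 i = ('d f (p + c *: v) v : 'rV_m) 0 i.
Proof.
move=> df.
pose g (t : R) : R := f (p + t *: v) 0 i.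
pose dg (t : R) : R := ('d f (p + t *: v) v : 'rV_m) 0 i.
have isd (t : R) : 0 <= t <= 1 -> is_derive t 1 g (dg t).
  move=> t01.
  have hd : differentiable f (p + t *: v) by exact: df.
  have ha : is_diff t (cst p + ( *:%R ^~ v)) (0 + ( *:%R ^~ v)) by exact: is_diffD.
  have hc : differentiable (f \o (cst p + ( *:%R ^~ v))) t.
    by apply: differentiable_comp; [exact: (ex_diff (is_diff_def:=ha))|exact: hd].
  have hcd : differentiable g t.
    have -> : g = (fun N : 'rV[R]_m => N 0 i) \o (f \o (cst p + ( *:%R ^~ v))) by [].
    by apply: differentiable_comp => //; exact: differentiable_coord.
  apply: DeriveDef; first exact: diff_derivable.
  have D1 : 'D_1 (f \o (cst p + ( *:%R ^~ v))) t = 'd f (p + t *: v) v.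
    by rewrite deriveE// diff_comp//= diff_val /= add0r scale1r.
  rewrite /dg -D1 derive_mx; last exact: diff_derivable.
  by rewrite mxE.
have [|||c c01 E] := @MVT_segment R g dg 0 1.
- exact: ler01.
- by move=> x; rewrite in_itv /= => /andP[x0 x1]; apply: isd; rewrite !ltW.
- apply: derivable_within_continuous => x; rewrite in_itv /= => x01.
  by have := isd x x01 => ?; exact: ex_derive.
exists c; first by move: c01; rewrite in_itv.
by move: E; rewrite /g /dg subr0 mulr1 scale1r scale0r addr0 !mxE.
Qed.

Lemma ball_segment (R : realType) (V : normedModType R) (a p v : V) (r t : R) :
  `|p - a| < r -> `|p + v - a| < r -> 0 <= t <= 1 -> `|p + t *: v - a| < r.
Proof.
move=> h1 h2 /andP[t0 t1].
have E : p + t *: v - a = (1 - t) *: (p - a) + t *: (p + v - a).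
  have -> : p + v - a = (p - a) + v by rewrite addrAC.
  by rewrite [t *: (_ + v)]scalerDr addrA -scalerDl subrK scale1r addrAC.
set m := Num.max `|p - a| `|p + v - a|.
have mr : m < r by rewrite gt_max h1 h2.
apply: le_lt_trans mr; rewrite E (le_trans (ler_normD _ _))// !normrZ.
rewrite (ger0_norm t0) ger0_norm ?subr_ge0//.
have -> : m = (1 - t) * m + t * m by ring.
by rewrite lerD// ler_wpM2l ?subr_ge0// le_max lexx ?orbT.
Qed.

(** Euler polygons stand in for the integral curves of the intrinsic vector fields:
    their vertices are obtained by iteration and compared by finite induction. The
    estimates along them are independent of the mesh and of the Lipschitz constant
    [L], which only says how fine the mesh has to be. *)
Section Euler.
Variables (R : realType) (n k : nat).
Local Notation d := (hdim n k).
Local Notation pt := (hpoint R n k).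
Variables (psi : pt -> 'rV[R]_k) (M0 : 'M[R]_(k, d)) (a0 : pt) (r L B e : R).
Hypothesis r0 : 0 < r.
Hypothesis L0 : 0 <= L.
Hypothesis e0 : 0 < e.
Hypothesis psi_diff : forall p, `|p - a0| < r -> differentiable psi p.
Hypothesis psi_bounded : forall p, `|p - a0| < r -> `|psi p| <= B.
Hypothesis diff_bounded : forall p v, `|p - a0| < r ->
  `|'d psi p v : 'rV_k| <= L * `|v|.
Hypothesis diff_close : forall p u, `|p - a0| < r ->
  `|('d psi p (lift (psi p) u p) : 'rV_k) - u *m M0^T| <= e * `|u|.

(** A bound for the length of [lift (psi p) u p] with [`|u| <= 1]. *)
Definition speed : R := 1 + k%:R * B + n%:R * (`|a0| + r).

Lemma value_bound_ge0 : 0 <= B.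
Proof. by rewrite (le_trans _ (psi_bounded (p := a0) _))// subrr normr0. Qed.

Lemma speed_ge1 : 1 <= speed.
Proof.
by rewrite /speed -addrA lerDl addr_ge0// mulr_ge0// ?value_bound_ge0// addr_ge0// ltW.
Qed.

Lemma lift_speed p u : `|p - a0| < r -> `|lift (psi p) u p| <= `|u| * speed.
Proof.
move=> pr; rewrite (le_trans (lift_norm _ _ _))// ler_wpM2l// lerD//.
  by rewrite lerD2l ler_wpM2l// psi_bounded.
rewrite ler_wpM2l// (le_trans (hproj_norm _))//.
by rewrite -[p](subrKC a0) (le_trans (ler_normD _ _))// lerD2l ltW.
Qed.

Lemma psi_lipschitz p q : `|p - a0| < r -> `|q - a0| < r ->
  `|psi q - psi p| <= L * `|q - p|.
Proof.
move=> pr qr; apply/mx_norm_leP; first exact: mulr_ge0.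
move=> i j; rewrite (ord1 i).
have seg t : 0 <= t <= 1 -> `|p + t *: (q - p) - a0| < r.
  by apply: ball_segment => //; rewrite subrKC.
have [t /seg ts|c /seg cs] := @mean_value_segment _ _ _ psi p (q - p) j.
  exact: psi_diff.
rewrite subrKC => ->; rewrite (le_trans (mx_entry_le _ _ _))//.
exact: diff_bounded.
Qed.

(** At a point [q] of the segment the displacement differs from the intrinsic field
    at [q] only by a vertical vector of size [`|psi p - psi q| * `|w|], because
    [sig w] is constant along the segment. By the Lipschitz bound this is quadratic
    in [w], hence absorbed when [w] is small. *)
Lemma euler_step p w : `|p - a0| < r -> `|p + lift (psi p) w p - a0| < r ->
  `|w| * (k%:R * L ^+ 2 * speed) <= e ->
  `|psi (p + lift (psi p) w p) - psi p - w *m M0^T| <= 2 * e * `|w|.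
Proof.
move=> pr pwr we; apply/mx_norm_leP; first by rewrite !mulr_ge0// ltW.
move=> i j; rewrite (ord1 i).
set v := lift (psi p) w p.
have seg t : 0 <= t <= 1 -> `|p + t *: v - a0| < r by exact: ball_segment.
have [t /seg ts|c c01 E] := @mean_value_segment _ _ _ psi p v j.
  exact: psi_diff.
have qr := seg c c01; set q := p + c *: v in E qr.
rewrite mxE E.
have -> : ('d psi q v : 'rV_k) 0 j + (- (w *m M0^T)) 0 j =
  ('d psi q v - w *m M0^T : 'rV_k) 0 j by rewrite [RHS]mxE.
rewrite (le_trans (mx_entry_le _ _ _))//.
have vE : v = lift (psi q) w q + mkpt 0 (pair (psi p - psi q) (eta_of w)).
  apply: hpoint_eq; rewrite ?hprojD ?taupartD ?hproj_lift ?taupart_lift ?hproj_mkpt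
     ?taupart_mkpt ?addr0//.
  by rewrite /q hprojD hprojZ hproj_lift sigDr sigZr sigxx pairBl; ring.
rewrite vE linearD /= addrAC mulrDl mul1r mulrDl.
rewrite (le_trans (ler_normD _ _))// lerD//; first exact: diff_close.
rewrite (le_trans (diff_bounded _ qr))//.
have h1 : `|mkpt 0 (pair (psi p - psi q) (eta_of w)) : pt| <=
   k%:R * (L * (`|w| * speed)) * `|w|.
  apply: hpoint_norm_le; rewrite ?hproj_mkpt ?normr0 ?taupart_mkpt.
    by rewrite !mulr_ge0// (le_trans _ speed_ge1).
  rewrite (le_trans (pair_le _ _))// ler_pM//.
    rewrite ler_wpM2l// distrC (le_trans (psi_lipschitz pr qr))// ler_wpM2l//.
    rewrite /q [p + _]addrC addrK normrZ ger0_norm; last by case/andP: c01.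
    rewrite (le_trans _ (lift_speed w pr))// ler_piMl//.
    by case/andP: c01.
  exact: eta_of_norm.
rewrite (le_trans (ler_wpM2l L0 h1))// [leLHS]mulrA ler_wpM2r//.
by rewrite (le_trans _ we)// le_eqVlt; apply/orP; left; apply/eqP; ring.
Qed.

Definition euler w p : pt := p + lift (psi p) w p.

Lemma hproj_iter_euler w p i : hproj (iter i (euler w) p) = hproj p + i%:R *: w.
Proof.
elim: i => [|i IH]; first by rewrite scale0r addr0.
by rewrite iterS /euler hprojD hproj_lift IH -addrA -[i.+1]addn1 natrD scalerDl scale1r.
Qed.

Lemma euler_polygon w p i : `|p - a0| < r / 2 ->
  i%:R * `|w| * speed <= r / 2 -> `|w| * (k%:R * L ^+ 2 * speed) <= e ->
  [/\ `|iter i (euler w) p - p| <= i%:R * `|w| * speed,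
      `|iter i (euler w) p - a0| < r &
      `|psi (iter i (euler w) p) - psi p - i%:R *: (w *m M0^T)|
        <= i%:R * (2 * e * `|w|)].
Proof.
move=> pr + we; have s0 : 0 <= speed by rewrite (le_trans _ speed_ge1).
elim: i => [|i IH] ir.
  split; rewrite /= ?subrr ?mul0r ?normr0// ?scale0r ?subr0 ?normr0//.
  by rewrite (lt_trans pr)// ltr_pdivrMr// ltr_pMr// ltr1n.
have [|h1 h2 h3] := IH.
  by rewrite (le_trans _ ir)// ler_wpM2r// ler_wpM2r// ler_nat.
set q := iter i (euler w) p in h1 h2 h3 *; rewrite iterS -/q.
have k1 : `|euler w q - p| <= i.+1%:R * `|w| * speed.
  have -> : euler w q - p = (q - p) + lift (psi q) w q by rewrite /euler addrAC.
  rewrite (le_trans (ler_normD _ _))// -[i.+1]addn1 natrD 2!mulrDl mul1r lerD//.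
  exact: lift_speed.
have k2 : `|euler w q - a0| < r.
  rewrite -(subrKA p) (le_lt_trans (ler_normD _ _))// [r]splitr addrC.
  by rewrite ltr_leD// (le_trans k1).
split => //.
have -> : psi (euler w q) - psi p - i.+1%:R *: (w *m M0^T) =
  (psi (euler w q) - psi q - w *m M0^T) + (psi q - psi p - i%:R *: (w *m M0^T)).
  rewrite -[i.+1]addn1 natrD scalerDl scale1r.
  by apply/rowP => j; rewrite !mxE; ring.
rewrite (le_trans (ler_normD _ _))// addrC -[i.+1]addn1 natrD mulrDl mul1r lerD//.
exact: euler_step.
Qed.

(** Each step moves with the slope at the current vertex, so the height above
    the plane with slope [psi p] only picks up the change of [psi]. *)
Lemma vdefect_iter_euler w p i c :
  (forall j, (j < i)%N -> `|psi (iter j (euler w) p) - psi p| <= c) ->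
  `|vdefect (psi p) (iter i (euler w) p) p| <= i%:R * (k%:R * c * `|w|).
Proof.
elim: i => [|i IH] h.
  rewrite /= /vdefect !subrr sigxx addr0 -(scale0r (0 : 'rV[R]_d)) eta_ofZ pairZr.
  by rewrite mul0r subr0 normr0 mul0r.
set q := iter i (euler w) p in IH h *.
have -> : vdefect (psi p) (iter i.+1 (euler w) p) p =
    vdefect (psi p) q p + pair (psi q - psi p) (eta_of w).
  rewrite iterS -/q /euler /vdefect hprojD taupartD hproj_lift taupart_lift.
  have sq : sig w (hproj q) = sig w (hproj p).
    by rewrite /q hproj_iter_euler sigDr sigZr sigxx mulr0 addr0.
  by rewrite (addrAC (hproj q)) (eta_ofD _ w) [pair _ (_ + eta_of w)]pairDr sigDl pairBl sq; ring.
rewrite (le_trans (ler_normD _ _))// -[i.+1]addn1 natrD mulrDl mul1r lerD//.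
  by apply: IH => j ji; apply: h; rewrite ltnS ltnW.
by rewrite (le_trans (pair_le _ _))// ler_pM// ?mulr_ge0// ?eta_of_norm// ler_wpM2l// h.
Qed.

Lemma fine_subdivision (x y : R) : 0 < y -> exists2 m : nat, (0 < m)%N & x / m%:R <= y.
Proof.
move=> y0; exists (Num.truncn (x / y)).+1 => //.
rewrite ler_pdivrMr// mulrC -ler_pdivrMr//; exact/ltW/truncnS_gt.
Qed.

(** Moving from [a] by the horizontal displacement [u] changes [psi] as its
    intrinsic differential predicts, at a vertical cost quadratic in [u], that is,
    of the order of the square of the intrinsic distance. *)
Lemma transport a u : `|a - a0| < r / 2 -> `|u| * speed <= r / 2 ->
  exists c : pt, [/\ hproj c = hproj a + u, `|c - a| <= `|u| * speed,
    `|psi c - psi a - u *m M0^T| <= 2 * e * `|u| &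
    `|vdefect (psi a) c a| <= k%:R * (d%:R * `|M0| + 2 * e) * `|u| ^+ 2].
Proof.
move=> ar ur; set A := k%:R * L ^+ 2 * speed.
have s0 : 0 <= speed by rewrite (le_trans _ speed_ge1).
have A0 : 0 <= A by rewrite !mulr_ge0// sqr_ge0.
have [m m0 hm] := @fine_subdivision (`|u| * A) e e0.
have mR : 0 < m%:R :> R by rewrite ltr0n.
pose w := m%:R^-1 *: u.
have nw : m%:R * `|w| = `|u|.
  by rewrite normrZ ger0_norm ?invr_ge0// mulVKf// gt_eqF.
have wA : `|w| * A <= e.
  by rewrite (le_trans _ hm)// -nw -mulrA (mulrC m%:R) mulfK// gt_eqF.
have mw : m%:R *: w = u by rewrite scalerA divff ?scale1r// gt_eqF.
have P i : (i <= m)%N -> `|psi (iter i (euler w) a) - psi a| <= (d%:R * `|M0| + 2 * e) * `|u|.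
  move=> im; have iu : i%:R * `|w| <= `|u| by rewrite -nw ler_wpM2r// ler_nat.
  have [|//|_ _ h] := @euler_polygon w a i ar.
    by rewrite (le_trans _ ur)// ler_wpM2r.
  rewrite -(subrK (i%:R *: (w *m M0^T)) (_ - _)) (le_trans (ler_normD _ _))//.
  rewrite addrC mulrDl lerD//.
    rewrite scalemxAl (le_trans (mulmx_norm_le _ _))// trmx_norm mulrAC.
    by rewrite ler_wpM2l ?mulr_ge0// normrZ ger0_norm.
  by rewrite (le_trans h)// mulrCA ler_wpM2l// mulr_ge0// ltW.
have [||h1 h2 h3] := @euler_polygon w a m ar.
- by rewrite nw.
- exact: wA.
exists (iter m (euler w) a); split.
- by rewrite hproj_iter_euler mw.
- by rewrite (le_trans h1)// nw.
- by move: h3; rewrite scalemxAl mw mulrCA nw.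
- rewrite (le_trans (vdefect_iter_euler (c := (d%:R * `|M0| + 2 * e) * `|u|) _))//.
    by move=> j jm; apply: P; exact: ltnW.
  by rewrite -nw le_eqVlt; apply/orP; left; apply/eqP; ring.
Qed.

Definition eta_dir (j : 'I_k) : 'rV[R]_d := row_mx (row_mx 0 (delta_mx 0 j)) 0.

Lemma eta_of_eta_dir j : eta_of (eta_dir j) = delta_mx 0 j.
Proof. by rewrite /eta_of /eta_dir row_mxKl row_mxKr. Qed.

Lemma eta_dir_norm j : `|eta_dir j| <= 1.
Proof.
by rewrite /eta_dir !row_mx_norm_le// ?normr0// delta_rV_norm.
Qed.

(** The two points are moved along the [eta_j] field, one way or the other. In this
    motion the gap between them changes at the rate [psi_j p - psi_j p'], up to an
    error [4 * e * t] since both values of [psi_j] evolve almost linearly with the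
    same slope. The gap cannot close, since [psi] is Lipschitz; a rate larger than
    stated, with the sign that shrinks the gap, would close it before time [t].
    Optimised over [t], this is a Hoelder estimate of exponent 1/2 along the centre
    with a small constant. *)
Lemma vertical_gap p p' (j : 'I_k) (t : R) : hproj p = hproj p' ->
  taupart p' < taupart p -> `|p - a0| < r / 2 -> `|p' - a0| < r / 2 ->
  0 < t -> t * speed <= r / 2 ->
  `|psi p 0 j - psi p' 0 j| <= (taupart p - taupart p') / t + 4 * e * t.
Proof.
move=> hpp tpp pr pr' t0 ts.
have s0 : 0 <= speed by rewrite (le_trans _ speed_ge1).
set A := k%:R * L ^+ 2 * speed.
have A0 : 0 <= A by rewrite !mulr_ge0// sqr_ge0.
set D := psi p 0 j - psi p' 0 j.
have e1 : 0 < Num.min e 1 by rewrite lt_min e0 ltr01.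
have [m m0] := @fine_subdivision (t * (A + L + 1)) _ e1.
set h := t / m%:R => hm0.
have mR : 0 < m%:R :> R by rewrite ltr0n.
have h0 : 0 < h by rewrite divr_gt0.
have hm : h * (A + L + 1) <= Num.min e 1 by rewrite (le_trans _ hm0)// /h mulrAC.
have hA : h * A <= e.
  rewrite (le_trans _ (le_trans hm _)) ?ge_min ?lexx//.
  by rewrite ler_wpM2l ?(ltW h0)// -addrA lerDl addr_ge0.
have hL : h * L < 1.
  rewrite (lt_le_trans _ (le_trans hm _)) ?ge_min ?lexx ?orbT//.
  by rewrite ltr_pM2l// -addrA -[X in X < _]add0r ler_ltD// ltrDl.
have mh : m%:R * h = t by rewrite mulrCA divff ?mulr1// gt_eqF.
(* the direction of motion in which the gap shrinks *)
pose s : R := if 0 <= D then -1 else 1.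
have sD : s * D = - `|D|.
  by rewrite /s; case: ger0P => _; rewrite ?mulN1r// mul1r opprK.
have ns : `|s| = 1 by rewrite /s; case: ifP; rewrite ?normrN normr1.
pose w := (h * s) *: eta_dir j.
have wh : `|w| <= h.
  rewrite normrZ normrM ns mulr1 ger0_norm ?(ltW h0)//.
  by rewrite ler_piMr ?(ltW h0)// eta_dir_norm.
have wA : `|w| * A <= e by rewrite (le_trans _ hA)// ler_wpM2r.
pose P i := iter i (euler w) p; pose P' i := iter i (euler w) p'.
pose G i := taupart (P i) - taupart (P' i).
have pol q i : `|q - a0| < r / 2 -> (i <= m)%N ->
    `|iter i (euler w) q - a0| < r /\
    `|psi (iter i (euler w) q) - psi q - i%:R *: (w *m M0^T)| <= 2 * e * t.
  move=> qr im.
  have ih : i%:R * `|w| <= t.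
    by rewrite -mh ler_pM// ler_nat.
  have [|//|_ k2 k3] := @euler_polygon w q i qr.
    by rewrite (le_trans _ ts)// ler_wpM2r.
  by split => //; rewrite (le_trans k3)// mulrCA ler_wpM2l// mulr_ge0// ltW.
have GS i : G i.+1 = G i + h * s * (psi (P i) - psi (P' i)) 0 j.
  have hh : hproj (P i) = hproj (P' i) by rewrite /P /P' !hproj_iter_euler hpp.
  rewrite /G /P /P' !iterS -/(P i) -/(P' i) /euler !taupartD !taupart_lift hh.
  have pE y : pair y (eta_of w) = h * s * y 0 j.
    rewrite /w eta_ofZ eta_of_eta_dir pairZr; congr (_ * _).
    rewrite /pair (bigD1 j)//= big1 ?addr0; first by rewrite !mxE !eqxx mulr1.
    by move=> i' /negbTE ij; rewrite !mxE ij andbF mulr0.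
  by rewrite !pE !mxE; ring.
(* One step shrinks the gap at most by the factor [1 - h * L], which is positive. *)
have Gpos i : (i <= m)%N -> 0 < G i.
  elim: i => [|i IH] im; first by rewrite /G subr_gt0.
  have Gi := IH (ltnW im); rewrite GS.
  have hh : hproj (P i) = hproj (P' i) by rewrite /P /P' !hproj_iter_euler hpp.
  have [Pr _] := pol _ _ pr (ltnW im); have [Pr' _] := pol _ _ pr' (ltnW im).
  have nG : `|P i - P' i| <= G i.
    apply: hpoint_norm_le; first by rewrite hprojB hh subrr normr0 ltW.
    by rewrite taupartB -/(G i) gtr0_norm.
  have : `|h * s * (psi (P i) - psi (P' i)) 0 j| < G i.
    rewrite (normrM (h * s)) (normrM h) ns mulr1 (gtr0_norm h0)//.
    apply: (@le_lt_trans _ _ (h * L * G i)); last by rewrite gtr_pMl.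
    rewrite -[leRHS]mulrA ler_wpM2l ?(ltW h0)// (le_trans (mx_entry_le _ _ _))//.
    by rewrite (le_trans (psi_lipschitz Pr' Pr))// ler_wpM2l.
  by rewrite ltr_norml => /andP[+ _]; rewrite -subr_gt0 opprK addrC.
have Gle i : (i <= m)%N -> G i <= G 0%N + i%:R * (h * (- `|D| + 4 * e * t)).
  elim: i => [|i IH] im; first by rewrite mul0r addr0.
  rewrite GS -[i.+1]addn1 natrD mulrDl mul1r addrA lerD ?IH ?(ltnW im)//.
  rewrite -mulrA ler_wpM2l ?(ltW h0)// -sD.
  have [_ Pr] := pol _ _ pr (ltnW im); have [_ Pr'] := pol _ _ pr' (ltnW im).
  rewrite -lerBlDl -mulrBr.
  have -> : (psi (P i) - psi (P' i)) 0 j - D =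
    (psi (P i) - psi p - i%:R *: (w *m M0^T)) 0 j -
    (psi (P' i) - psi p' - i%:R *: (w *m M0^T)) 0 j.
    by rewrite /D !mxE; ring.
  rewrite (le_trans (ler_norm _))// normrM ns mul1r (le_trans (ler_normB _ _))//.
  have -> : 4 * e * t = 2 * e * t + 2 * e * t by ring.
  by rewrite lerD// (le_trans (mx_entry_le _ _ _)).
have := lt_le_trans (Gpos m (leqnn m)) (Gle m (leqnn m)).
rewrite mulrA mh mulrDr mulrN addrCA -subr_gt0 subr0 => H.
rewrite -(ler_pM2r t0) mulrDl divfK ?gt_eqF//.
by move: H; rewrite /G /P /P' /= => H; lra.
Qed.

End Euler.

(** * Smooth approximations force uniform intrinsic differentiability *)

(** From [a] one reaches [b] by [transport] to a point [c] above or below [b] and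
    then along the vertical, where [vertical_gap] applies. The closeness [e] of the
    Jacobians to [M0] is chosen first and depends only on [eps] and [M0]; the
    radius [r'] depends on the bound [B] but neither on [psi] nor on its Lipschitz
    constant [L], so that the estimate survives a uniform limit. *)
Lemma uniform_taylor (R : realType) (n k : nat) (M0 : 'M[R]_(k, hdim n k)) (eps : R) :
  0 < eps -> exists2 e : R, 0 < e & forall (a0 : hpoint R n k) (r B : R), 0 < r -> 0 <= B ->
  exists2 r' : R, 0 < r' & forall (psi : hpoint R n k -> 'rV[R]_k) (L : R), 0 <= L ->
  (forall p, `|p - a0| < r -> differentiable psi p) ->
  (forall p, `|p - a0| < r -> `|psi p| <= B) ->
  (forall p v, `|p - a0| < r -> `|'d psi p v : 'rV_k| <= L * `|v|) ->
  (forall p u, `|p - a0| < r ->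
     `|('d psi p (lift (psi p) u p) : 'rV_k) - u *m M0^T| <= e * `|u|) ->
  forall a b, `|a - a0| < r' -> `|b - a0| < r' ->
  `|taylor_err psi M0 a b| <= eps * intrinsic_dist psi b a.
Proof.
move=> eps0; pose Q : R := k%:R * ((hdim n k)%:R * `|M0| + 2).
have Q0 : 0 <= Q by rewrite mulr_ge0// addr_ge0// mulr_ge0.
have Q1 : 0 < 7 + 5 * Q by rewrite ltr_wpDr// mulr_ge0.
pose h : R := Num.min 1 (eps / (7 + 5 * Q)).
have h0 : 0 < h by rewrite lt_min ltr01 divr_gt0.
have h1 : h <= 1 by rewrite ge_min lexx.
have heps : h * (7 + 5 * Q) <= eps by rewrite -ler_pdivlMr// ge_min lexx orbT.
have hh0 : 0 < h ^+ 2 by rewrite exprn_gt0.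
exists (h ^+ 2) => // a0 r B r0 B0.
pose S := speed a0 r B.
have S1 : 1 <= S by rewrite /S /speed -addrA lerDl addr_ge0// mulr_ge0// addr_ge0// ltW.
have S0 : 0 < S by rewrite (lt_le_trans ltr01).
pose x : R := r / 4 / (1 + 2 * S).
pose y : R := (h * r / (2 * S)) ^+ 2 / (2 + 2 * S).
have x0 : 0 < x by rewrite !divr_gt0// addr_gt0// mulr_gt0.
have y0 : 0 < y by rewrite divr_gt0// ?exprn_gt0// ?divr_gt0// ?addr_gt0// ?mulr_gt0.
exists (Num.min x y); first by rewrite lt_min x0.
set r' := Num.min x y => psi L L0 H1 H2 H3 H4 a b ar br.
have r'0 : 0 < r' by rewrite lt_min x0.
have rS : r' * (1 + 2 * S) <= r / 4.
  by rewrite -ler_pdivlMr ?ge_min ?lexx// addr_gt0// mulr_gt0.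
have rS1 : r' <= r / 4.
  by rewrite (le_trans _ rS)// ler_peMr ?(ltW r'0)// lerDl mulr_ge0// ltW.
have r4 : r / 4 < r / 2 by rewrite ltr_pM2l// ltf_pV2 ?posrE// ltr_nat.
set u := hproj b - hproj a.
set D := intrinsic_dist psi b a.
have uD : `|u| <= D by exact: norm_le_dist.
have D0 : 0 <= D by exact: intrinsic_dist_ge0.
have ba : `|b - a| <= 2 * r'.
  rewrite -(subrKA a0) (le_trans (ler_normD _ _))// mulrDl mul1r.
  by rewrite [`|a0 - a|]distrC lerD// ltW.
have ur : `|u| <= 2 * r' by rewrite /u -hprojB (le_trans (hproj_norm _)).
have uS : `|u| * S <= r / 2.
  rewrite (le_trans (ler_wpM2r (ltW S0) ur))// (le_trans _ (ltW r4))// (le_trans _ rS)//.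
  by rewrite -subr_ge0 (_ : _ - _ = r') ?(ltW r'0)//; ring.
have ar2 : `|a - a0| < r / 2 by rewrite (lt_trans ar)// (le_lt_trans rS1).
have br2 : `|b - a0| < r / 2 by rewrite (lt_trans br)// (le_lt_trans rS1).
have [c [ca cn cpsi cv]] := transport r0 L0 hh0 H1 H2 H3 H4 ar2 uS.
have cn' : `|c - a| <= 2 * r' * S.
  by rewrite (le_trans cn)// ler_wpM2r// ltW.
have cr2 : `|c - a0| < r / 2.
  rewrite -(subrKA a) (le_lt_trans (ler_normD _ _))//.
  apply: (@lt_le_trans _ _ (2 * r' * S + r')); first by rewrite ler_ltD.
  rewrite (le_trans _ (ltW r4))// (le_trans _ rS)//.
  by rewrite le_eqVlt; apply/orP; left; apply/eqP; ring.
have hcb : hproj c = hproj b by rewrite ca /u subrKC.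
have h2 : h ^+ 2 <= 1 by rewrite exprn_ile1// ltW.
pose G := `|taupart b - taupart c|.
have GQ : G <= (1 + Q) * D ^+ 2.
  have -> : G = `|vdefect (psi a) b a - vdefect (psi a) c a|.
    by rewrite /G /vdefect hcb; congr (`|_|); ring.
  rewrite (le_trans (ler_normB _ _))// mulrDl mul1r lerD//.
    exact: vdefect_le_dist.
  rewrite (le_trans cv)// ler_pM//.
  - by rewrite mulr_ge0// addr_ge0// mulr_ge0// ltW.
  - by rewrite ler_wpM2l// lerD2l ler_piMr.
  - by rewrite ler_pXn2r ?nnegrE.
have Gr : Num.sqrt G <= h * r / (2 * S).
  have e1 : 0 <= h * r / (2 * S) by rewrite divr_ge0// mulr_ge0// ltW.
  rewrite -[leRHS](ger0_norm e1) -[leRHS]sqrtr_sqr ler_wsqrtr//.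
  apply: (@le_trans _ _ (r' * (2 + 2 * S))).
    rewrite /G -taupartB (le_trans (taupart_norm _))// -(subrKA a).
    rewrite (le_trans (ler_normD _ _))// mulrDr [r' * 2]mulrC lerD//.
    by rewrite distrC (le_trans cn')// le_eqVlt; apply/orP; left; apply/eqP; ring.
  by rewrite -ler_pdivlMr ?ge_min ?lexx ?orbT// addr_gt0// mulr_gt0.
have GD : Num.sqrt G <= (1 + Q) * D.
  have e1 : 0 <= (1 + Q) * D by rewrite mulr_ge0// addr_ge0.
  rewrite -[leRHS](ger0_norm e1) -[leRHS]sqrtr_sqr ler_wsqrtr//.
  rewrite (le_trans GQ)// exprMn ler_wpM2r ?sqr_ge0// expr2 ler_peMl ?addr_ge0//.
  by rewrite lerDl.
have bc : `|psi b - psi c| <= 5 * h * ((1 + Q) * D).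
  have rhs0 : 0 <= 5 * h * ((1 + Q) * D) by rewrite !mulr_ge0 ?addr_ge0// ltW.
  have [tbc|tbc] := eqVneq (taupart b) (taupart c).
    by rewrite (hpoint_eq (esym hcb) tbc) subrr normr0.
  have G0 : 0 < G by rewrite normr_gt0 subr_eq0.
  have sG0 : 0 < Num.sqrt G by rewrite sqrtr_gt0.
  (* This time balances the two terms of [vertical_gap], where [e] is [h ^+ 2]. *)
  have t0 : 0 < Num.sqrt G / h by rewrite divr_gt0.
  have tS : Num.sqrt G / h * S <= r / 2.
    rewrite mulrAC ler_pdivrMr// -ler_pdivlMr// (le_trans Gr)//.
    by rewrite invfM mulrA [r / 2 * h]mulrAC [r * h]mulrC.
  apply/mx_norm_leP => // i j; rewrite (ord1 i).
  have E : G / (Num.sqrt G / h) + 4 * h ^+ 2 * (Num.sqrt G / h) = 5 * h * Num.sqrt G.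
    rewrite -{1}(sqr_sqrtr (ltW G0)); field.
    by rewrite !gt_eqF.
  rewrite (le_trans _ (ler_wpM2l _ GD))//; last by rewrite mulr_ge0// ltW.
  rewrite -E !mxE; move: tbc; rewrite neq_lt => /orP[tlt|tlt].
    have gE : taupart c - taupart b = G by rewrite /G distrC gtr0_norm ?subr_gt0.
    have := vertical_gap r0 L0 hh0 H1 H2 H3 H4 j hcb tlt cr2 br2 t0 tS.
    by rewrite gE distrC.
  have gE : taupart b - taupart c = G by rewrite /G gtr0_norm ?subr_gt0.
  have := vertical_gap r0 L0 hh0 H1 H2 H3 H4 j (esym hcb) tlt br2 cr2 t0 tS.
  by rewrite gE.
have -> : taylor_err psi M0 a b = (psi c - psi a - u *m M0^T) + (psi b - psi c).
  by rewrite /taylor_err -/u [RHS]addrC addrA subrKA.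
rewrite (le_trans (ler_normD _ _))// (le_trans (lerD cpsi bc))//.
apply: (@le_trans _ _ (2 * h * D + 5 * h * ((1 + Q) * D))).
  have hge0 := ltW h0; rewrite lerD2r ler_pM// ?mulr_ge0//.
  by rewrite ler_wpM2l// expr2 ler_piMr// ltW.
have -> : 2 * h * D + 5 * h * ((1 + Q) * D) = h * (7 + 5 * Q) * D by ring.
by rewrite ler_wpM2r.
Qed.

Section Topology.
Variable R : realType.

Lemma open_norm_ball (V : normedModType R) (A : set V) a : open A -> A a ->
  exists2 r : R, 0 < r & forall p, `|p - a| < r -> A p.
Proof.
move=> oA Aa; have /nbhs_ballP[r /= r0 hr] := open_nbhs_nbhs (conj oA Aa).
exists r => // p pr; apply: hr; by rewrite -ball_normE /= distrC.
Qed.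

Lemma continuous_norm_ball (V W : normedModType R) (f : V -> W) a (e : R) :
  {for a, continuous f} -> 0 < e ->
  exists2 r : R, 0 < r & forall p, `|p - a| < r -> `|f p - f a| < e.
Proof.
move=> /cvgrPdistC_lt cf e0; have /nbhs_ballP[r /= r0 hr] := cf e e0.
by exists r => // p pr; apply: hr; rewrite -ball_normE /= distrC.
Qed.

Lemma lipschitz_continuous (V W : normedModType R) (f : V -> W) y (C : R) :
  (forall y', `|f y - f y'| <= C * `|y - y'|) -> {for y, continuous f}.
Proof.
move=> h; apply/cvgrPdist_le => e e0; have C1 : 0 < `|C| + 1 by rewrite ltr_wpDl.
near=> y'; rewrite (le_trans (h y'))//.
have : `|y - y'| <= e / (`|C| + 1).
  by near: y'; apply: cvgr_dist_le; rewrite ?divr_gt0.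
rewrite ler_pdivlMr// => h'; rewrite (le_trans _ h')// mulrC ler_wpM2l//.
by rewrite (le_trans (ler_norm _))// lerDl.
Unshelve. all: by end_near. Qed.

Lemma within_open_continuous (V W : topologicalType) (A : set V) (f : V -> W) a :
  open A -> {within A, continuous f} -> A a -> {for a, continuous f}.
Proof. by move=> oA; rewrite continuous_open_subspace// => h Aa; apply: h; exact/mem_set. Qed.

Lemma uniform_cvgP (l m p : nat) (A : set 'rV[R]_l)
    (f : R -> 'rV[R]_l -> 'M[R]_(m, p)) (g : 'rV[R]_l -> 'M[R]_(m, p)) :
  {uniform A, f e @[e --> (0 : R)^'+] --> g} <->
  forall eps : R, 0 < eps -> \forall e \near (0 : R)^'+,
    forall x, A x -> `|g x - f e x| < eps.
Proof.
split=> [h eps eps0|h P /uniform_nbhs[E [entE EP]]].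
  have : nbhs (g : {uniform` A -> 'M[R]_(m, p)}) [set h | forall y, A y -> ball (g y) eps (h y)].
    apply/uniform_nbhs; exists [set xy | ball xy.1 eps xy.2]; split=> //.
    by rewrite -entourage_ballE; exists eps.
  move=> /h H; apply: (@filterS _ ((0 : R)^'+) _ _ _ _ H) => e he x Ax.
  by have := he x Ax; rewrite -ball_normE.
move: entE; rewrite -entourage_ballE => -[eps /= eps0 hE].
apply: (@filterS _ ((0 : R)^'+) _ _ _ _ (h eps eps0)) => e he.
apply: EP => y Ay; apply: hE; rewrite /= -ball_normE; exact: he.
Qed.

Lemma closed_norm_ball (V : normedModType R) (a : V) (r : R) :
  closed [set p | `|p - a| <= r].
Proof.
apply: (@closed_comp _ _ (fun p : V => `|p - a|) [set x | x <= r]).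
  move=> p _; apply: cvg_norm; apply: cvgB; [exact: cvg_id|exact: cvg_cst].
exact: closed_le.
Qed.

Lemma compact_norm_ball (m : nat) (a : 'rV[R]_m) (r : R) :
  compact [set p : 'rV[R]_m | `|p - a| <= r].
Proof.
apply: bounded_closed_compact; last exact: closed_norm_ball.
exists (r + `|a|); split; first exact: num_real.
move=> x rx p /= pr; rewrite (le_trans _ (ltW rx))//.
by rewrite -[p](subrK a) (le_trans (ler_normD _ _))// lerD2r.
Qed.

Lemma norm_ball_compactly_inside (m : nat) (A : set 'rV[R]_m) (a : 'rV[R]_m) (r : R) :
  (forall p, `|p - a| <= r -> A p) -> compactly_inside [set p | `|p - a| < r] A.
Proof.
move=> rA; have cl : closure [set p | `|p - a| < r] `<=` [set p | `|p - a| <= r].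
  rewrite [X in _ `<=` X](iffLR (closure_id _) (@closed_norm_ball _ a r)).
  by apply: closure_subset => p /= /ltW.
split; last by move=> p /cl; exact: rA.
apply: subclosed_compact cl; [exact: closed_closure|exact: compact_norm_ball].
Qed.

Lemma open_norm_lt (V : normedModType R) (a : V) (r : R) : open [set p | `|p - a| < r].
Proof.
apply: (@open_comp _ _ (fun p : V => `|p - a|) [set x | x < r]); last exact: open_lt.
move=> p _; apply: cvg_norm; apply: cvgB; [exact: cvg_id|exact: cvg_cst].
Qed.

Lemma C1_diff_bounded (m p : nat) (A : set 'rV[R]_m) (f : 'rV[R]_m -> 'rV[R]_p) a (r : R) :
  open A -> C1_on A f -> (forall x, `|x - a| <= r -> A x) ->
  exists2 L : R, 0 <= L & forall x v, `|x - a| <= r -> `|'d f x v : 'rV_p| <= L * `|v|.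
Proof.
move=> oA [df cJ] rA; set K := [set x | `|x - a| <= r].
have cK : compact (jacobian f @` K).
  apply: continuous_compact; last exact: compact_norm_ball.
  by apply: continuous_subspaceW cJ => x /rA.
have [M0 [_ hM]] := compact_bounded cK.
pose M := Num.max (M0 + 1) 0; exists (m%:R * M) => [|x v xr].
  by rewrite mulr_ge0// le_max lexx orbT.
have -> : 'd f x v = v *m jacobian f x by rewrite /jacobian mul_rV_lin1.
rewrite (le_trans (mulmx_norm_le _ _))// mulrAC ler_wpM2r// ler_wpM2l//.
apply: (hM M); last by exists x.
by rewrite lt_max ltrDl ltr01.
Qed.

End Topology.

Section Limit.
Variables (R : realType) (n k : nat).
Local Notation d := (hdim n k).
Local Notation pt := (hpoint R n k).

Lemma intrinsic_dist_cvg (f : R -> pt -> 'rV[R]_k) (phi : pt -> 'rV[R]_k) a b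
    (F : set_system R) {FF : Filter F} :
  f e a @[e --> F] --> phi a ->
  intrinsic_dist (f e) b a @[e --> F] --> intrinsic_dist phi b a.
Proof.
move=> cv; pose h (y : 'rV[R]_k) : R :=
  Num.max (enorm (hproj b - hproj a)) (Num.sqrt `|vdefect y b a|).
have -> : (fun e => intrinsic_dist (f e) b a) = h \o (f ^~ a).
  by apply/funext => e; rewrite intrinsic_distE.
rewrite intrinsic_distE -/(h (phi a)).
apply: continuous_cvg cv; move: (phi a) => y.
have cvd : {for y, continuous (fun y : 'rV[R]_k => vdefect y b a)}; last first.
  apply: (@continuous_max _ _ (cst (enorm (hproj b - hproj a)))
     (fun y => Num.sqrt `|vdefect y b a|)); first exact: cst_continuous.
  apply: (@continuous_comp _ _ _ (fun y => `|vdefect y b a|)); last exact: sqrt_continuous.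
  exact: cvg_norm cvd.
set z := eta_of (hproj b - hproj a).
apply: (@lipschitz_continuous _ _ _ _ _ (k%:R * `|z|)) => y'.
have -> : vdefect y b a - vdefect y' b a = - pair (y - y') z.
  by rewrite /vdefect -/z pairBl; ring.
by rewrite normrN mulrAC pair_le.
Qed.

(** The estimates of [uniform_taylor] hold for all the approximations with the same
    constants, and both sides pass to the limit at fixed [a] and [b]. *)
Theorem uid_of_approximation (Omega : set pt) (phi : pt -> 'rV[R]_k)
    (phi_ : R -> pt -> 'rV[R]_k) (M : pt -> 'M[R]_(k, d)) :
  open Omega -> {within Omega, continuous phi} ->
  (forall eps : R, 0 < eps -> C1_on Omega (phi_ eps)) ->
  {within Omega, continuous M} ->
  (forall Omega' : set pt, open Omega' -> compactly_inside Omega' Omega ->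
     {uniform Omega', phi_ eps @[eps --> (0 : R)^'+] --> phi} /\
     {uniform Omega', intrinsic_jacobian (phi_ eps) @[eps --> (0 : R)^'+] --> M}) ->
  forall a0, Omega a0 -> uid_with phi (M a0) a0.
Proof.
move=> oO cphi C1 cM cvg a0 Oa0 eps eps0.
have [e e0 UT] := @uniform_taylor R n k (M a0) eps eps0.
have [r1 r1_gt0 h1] := open_norm_ball oO Oa0.
have [r2 r2_gt0 h2] := continuous_norm_ball (within_open_continuous oO cphi Oa0) ltr01.
pose e1 := e / (2 * (d%:R + 1)).
have e1_gt0 : 0 < e1 by rewrite divr_gt0// mulr_gt0// ltr_wpDl.
have [r3 r3_gt0 h3] := continuous_norm_ball (within_open_continuous oO cM Oa0) e1_gt0.
pose r := Num.min (r1 / 2) (Num.min r2 r3).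
have r_gt0 : 0 < r by rewrite !lt_min r2_gt0 r3_gt0 divr_gt0.
have rO p : `|p - a0| <= r -> Omega p.
  move=> pr; apply: h1; rewrite (le_lt_trans pr)// gt_min.
  by rewrite ltr_pdivrMr// ltr_pMr// ltr1n.
have [cv1 cv2] := cvg _ (open_norm_lt a0 r) (norm_ball_compactly_inside rO).
have u1 := iffLR (uniform_cvgP _ _ _) cv1 1 ltr01.
have u2 := iffLR (uniform_cvgP _ _ _) cv2 e1 e1_gt0.
pose B := `|phi a0| + 2.
have [r' r'_gt0 hr'] := UT a0 r B r_gt0 (addr_ge0 (normr_ge0 _) (ler0n _ _)).
pose s := Num.min r r'; have s0 : 0 < s by rewrite lt_min r_gt0.
exists s => // a b as_ bs_.
have ar : `|a - a0| < r by rewrite (lt_le_trans as_)// ge_min lexx.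
have br : `|b - a0| < r by rewrite (lt_le_trans bs_)// ge_min lexx.
have ar' : `|a - a0| < r' by rewrite (lt_le_trans as_)// ge_min lexx orbT.
have br' : `|b - a0| < r' by rewrite (lt_le_trans bs_)// ge_min lexx orbT.
have key : \forall t \near (0 : R)^'+,
    `|taylor_err (phi_ t) (M a0) a b| <= eps * intrinsic_dist (phi_ t) b a.
  near=> t; have t0 : 0 < t by near: t; exact: nbhs_right_gt.
  have v1 : forall x, `|x - a0| < r -> `|phi x - phi_ t x| < 1 by near: t.
  have v2 : forall x, `|x - a0| < r -> `|M x - intrinsic_jacobian (phi_ t) x| < e1.
    by near: t.
  have [L L0 hL] := C1_diff_bounded oO (C1 t t0) rO.
  apply: (hr' (phi_ t) L L0) => //.
  - by move=> p /ltW/rO; apply: (C1 t t0).1.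
  - move=> p pr; rewrite -[phi_ t p](subKr (phi p)) (le_trans (ler_normB _ _))//.
    rewrite /B (_ : 2 = 1 + 1 :> R)// addrA lerD ?(ltW (v1 _ pr))//.
    rewrite -[phi p](subrK (phi a0)) (le_trans (ler_normD _ _))// [leRHS]addrC lerD2r ltW//.
    by apply: h2; rewrite (lt_le_trans pr)// !ge_min lexx orbT.
  - by move=> p v /ltW; exact: hL.
  - move=> p u pr; rewrite -intrinsic_jacobian_diff; last exact/((C1 t t0).1)/rO/ltW.
    rewrite -mulmxBr -linearB /= (le_trans (mulmx_norm_le _ _))// trmx_norm.
    rewrite mulrAC ler_wpM2r//.
    have v3 : `|M p - M a0| < e1.
      by apply: h3; rewrite (lt_le_trans pr)// !ge_min lexx !orbT.
    have v4 : `|intrinsic_jacobian (phi_ t) p - M a0| <= e1 + e1.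
      rewrite -(subrKA (M p)) (le_trans (ler_normD _ _))// lerD ?(ltW v3)//.
      by rewrite distrC (ltW (v2 _ pr)).
    rewrite (le_trans (ler_wpM2l _ v4))//.
    have -> : d%:R * (e1 + e1) = e * (d%:R / (d%:R + 1)).
      by rewrite /e1; field; rewrite gt_eqF// ltr_wpDl.
    by rewrite ler_piMr ?(ltW e0)// ler_pdivrMr ?ltr_wpDl// mul1r lerDl.
have pc x : `|x - a0| < r -> phi_ t x @[t --> (0 : R)^'+] --> phi x.
  move=> xr; apply/cvgrPdist_lt => eta eta0.
  by apply: filterS (iffLR (uniform_cvgP _ _ _) cv1 eta eta0) => t; apply.
have c1 : `|taylor_err (phi_ t) (M a0) a b| @[t --> (0 : R)^'+] -->
    `|taylor_err phi (M a0) a b|.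
  apply: cvg_norm; apply: cvgB; last exact: cvg_cst.
  by apply: cvgB; apply: pc.
have c2 : eps * intrinsic_dist (phi_ t) b a @[t --> (0 : R)^'+] -->
    eps * intrinsic_dist phi b a.
  apply: cvgM; first exact: cvg_cst.
  by apply: intrinsic_dist_cvg; exact: pc.
exact: (ler_cvg_to c1 c2 key).
Unshelve. all: by end_near. Qed.

End Limit.

(** * Continuously differentiable scalar functions *)

Section C1Calculus.
Variables (R : realType) (V : normedModType R).
Implicit Types (f g : V -> R) (df dg : V -> V -> R).

(** Carrying the differential as a second argument makes the closure lemmas
    compute it at the same time as they establish regularity. *)
Definition C1_with f df :=
  [/\ forall x, differentiable f x, forall x v, 'd f x v = df x v &
      forall v, continuous (df ^~ v)].

Lemma C1_continuous f df : C1_with f df -> continuous f.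
Proof. by case=> h _ _ x; exact: differentiable_continuous. Qed.

Lemma C1_cst (c : R) : C1_with (fun=> c) (fun _ _ => 0).
Proof.
split=> [x|x v|v]; [exact: differentiable_cst| |exact: cst_continuous].
by rewrite (@diff_cst _ _ _ c).
Qed.

Lemma C1_add f df g dg : C1_with f df -> C1_with g dg ->
  C1_with (fun y => f y + g y) (fun x v => df x v + dg x v).
Proof.
case=> f1 f2 f3 [g1 g2 g3]; split=> [x|x v|v].
- exact: differentiableD.
- by rewrite (diffD (f1 x) (g1 x)) /= f2 g2.
- by move=> x; apply: cvgD; [exact: (f3 v x)|exact: (g3 v x)].
Qed.

Lemma C1_mul f df g dg : C1_with f df -> C1_with g dg ->
  C1_with (fun y => f y * g y) (fun x v => df x v * g x + f x * dg x v).
Proof.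
move=> F G; have cf := C1_continuous F; have cg := C1_continuous G.
case: F G => f1 f2 f3 [g1 g2 g3]; split=> [x|x v|v].
- exact: differentiableM.
- rewrite (diffM (f1 x) (g1 x)) /= -[LHS]/(f x * 'd g x v + g x * 'd f x v).
  by rewrite f2 g2; ring.
- by move=> x; apply: cvgD; apply: cvgM; [exact: (f3 v x)|exact: cg|exact: cf|exact: (g3 v x)].
Qed.

Lemma C1_ext f df g dg : f =1 g -> df =2 dg -> C1_with f df -> C1_with g dg.
Proof.
move=> /funext <- h; have -> // : dg = df.
by apply/funext => x; apply/funext => v; rewrite h.
Qed.

Lemma C1_scale (c : R) f df : C1_with f df ->
  C1_with (fun y => c * f y) (fun x v => c * df x v).
Proof.
move=> h; apply: C1_ext (C1_mul (C1_cst c) h) => // x v.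
by rewrite mul0r add0r.
Qed.

Lemma C1_sum (I : Type) (s : seq I) (f : I -> V -> R) (df : I -> V -> V -> R) :
  (forall i, C1_with (f i) (df i)) ->
  C1_with (fun y => \sum_(i <- s) f i y) (fun x v => \sum_(i <- s) df i x v).
Proof.
move=> h; elim: s => [|i s IH].
  by apply: C1_ext (C1_cst 0) => [x|x v]; rewrite big_nil.
by apply: C1_ext (C1_add (h i) IH) => [x|x v]; rewrite big_cons.
Qed.

Lemma C1_inv f df : (forall x, f x != 0) -> C1_with f df ->
  C1_with (fun y => (f y)^-1) (fun x v => - (f x ^- 2 * df x v)).
Proof.
move=> f0 F; have cf := C1_continuous F.
case: F => f1 f2 f3; split=> [x|x v|v].
- exact: differentiableV.
- by rewrite (diffV (f1 x) (f0 x)) /= -[LHS]/(- f x ^- 2 * 'd f x v) f2 mulNr.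
- move=> x; apply: cvgN; apply: cvgM; last exact: (f3 v x).
  apply: cvgV; first by rewrite expf_neq0.
  by apply: cvgM; exact: cf.
Qed.

Lemma C1_comp (t t' : R -> R) f df : (forall y : R, is_derive y 1 t (t' y)) ->
  continuous t' -> C1_with f df ->
  C1_with (fun y => t (f y)) (fun x v => df x v * t' (f x)).
Proof.
move=> ht ct F; have cf := C1_continuous F; case: F => f1 f2 f3.
have dt y : differentiable t y by apply/derivable1_diffP.
split=> [x|x v|v].
- by apply: differentiable_comp.
- rewrite (diff_comp (f1 x) (dt (f x))) /= deriv1E // derive1E derive_val.
  by rewrite -[LHS]/('d f x v * t' (f x)) f2.
- move=> x; apply: cvgM; first exact: (f3 v x).
  by apply: continuous_cvg; [exact: ct|exact: cf].
Qed.

End C1Calculus.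

Section C1Affine.
Variables (R : realType) (m : nat).
Local Notation V := 'rV[R]_m.

Lemma C1_coord (i : 'I_m) : C1_with (fun y : V => y 0 i) (fun _ v => v 0 i).
Proof.
split=> [x|x v|v]; [exact: differentiable_coord| |exact: cst_continuous].
rewrite -deriveE; last exact: differentiable_coord.
rewrite /derive; apply: cvg_lim => //.
apply/cvgrPdist_le => e e0; near=> h; rewrite /= !mxE addrK /=.
have h0 : h != 0 by near: h; exact: nbhs_dnbhs_neq.
by rewrite /GRing.scale /= mulKf// subrr normr0 ltW.
Unshelve. all: by end_near. Qed.

Lemma C1_affine (l f : V -> R) : (forall v w, l (v + w) = l v + l w) ->
  (forall c v, l (c *: v) = c * l v) -> (forall y, f y = f 0 + l y) ->
  C1_with f (fun _ v => l v).
Proof.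
move=> lD lZ fl.
have l0 : l 0 = 0 by rewrite -(scale0r (0 : V)) lZ mul0r.
have lE v : l v = \sum_(i <- enum 'I_m) v 0 i * l (delta_mx 0 i).
  rewrite big_enum [in LHS](row_sum_delta v) (big_morph l lD l0).
  by apply: eq_bigr => i _; rewrite lZ.
have := @C1_sum _ _ _ (enum 'I_m) _ _ (fun i => C1_mul (C1_coord i) (C1_cst _ (l (delta_mx 0 i)))).
move=> /(C1_add (C1_cst _ (f 0))); apply: C1_ext => [y|x v].
  by rewrite [RHS]fl lE.
by rewrite add0r lE; apply: eq_bigr => i _; rewrite mulr0 addr0.
Qed.

End C1Affine.

Section C1Row.
Variables (R : realType) (m p : nat).

Lemma continuous_mx (T : topologicalType) (q l : nat) (F : T -> 'M[R]_(q, l)) x :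
  (forall i j, {for x, continuous (fun y => F y i j)}) -> {for x, continuous F}.
Proof.
move=> h; apply/cvgrPdist_le => e e0.
have H i j : \forall y \near x, `|F x i j - F y i j| <= e.
  by move: (h i j) => /cvgrPdist_le; apply.
near=> y; apply/mx_norm_leP; first exact: ltW.
move=> i j; rewrite !mxE; move: i j; near: y.
by apply: filter_forall => i; apply: filter_forall => j; exact: H.
Unshelve. all: by end_near. Qed.

Lemma C1_row (f : 'I_p -> 'rV[R]_m -> R) (df : 'I_p -> 'rV[R]_m -> 'rV[R]_m -> R) :
  (forall j, C1_with (f j) (df j)) ->
  let F := fun x => \row_j f j x : 'rV[R]_p in
  [/\ forall x, differentiable F x,
      forall x v, 'd F x v = \row_j df j x v &
      forall A, C1_on A F].
Proof.
move=> h F.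
have dF x : differentiable F x.
  have -> : F = \sum_(j < p) (fun y => f j y *: (delta_mx 0 j : 'rV[R]_p)).
    apply/funext => y; rewrite fct_sumE [LHS]row_sum_delta.
    by apply: eq_bigr => j _; rewrite mxE.
  apply: differentiable_sum => j; apply: differentiableZl.
  by case: (h j).
have dE x v : 'd F x v = \row_j df j x v.
  rewrite -deriveE// derive_mx; last exact: diff_derivable.
  apply/matrixP => i j; rewrite (ord1 i) !mxE.
  have -> : (fun t => F t 0 j) = f j by apply/funext => t; rewrite mxE.
  by case: (h j) => h1 h2 _; rewrite deriveE.
split=> // A; split=> [a _|]; first exact: dF.
apply: continuous_subspaceT => x; apply: continuous_mx => i j.
have -> : (fun y => jacobian F y i j) = (df j) ^~ (delta_mx 0 i).
  by apply/funext => y; rewrite /jacobian mxE dE mxE.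
by case: (h j) => _ _; apply.
Qed.

End C1Row.

Section Bump.
Variable R : realType.

(** The simplest [C^1] profile that is positive exactly on the positive
    numbers; the bumps are this function of [1 - gauge]. *)
Definition sqpos (y : R) : R := Num.max 0 y ^+ 2.

Lemma max0_lipschitz (a b : R) : `|Num.max 0 a - Num.max 0 b| <= `|a - b|.
Proof.
case: (lerP 0 a) => ha; case: (lerP 0 b) => hb //.
- by rewrite subr0 !ger0_norm// ?lerDl ?subr_ge0 ?oppr_ge0 ltW// (lt_le_trans hb).
- by rewrite sub0r normrN ger0_norm// distrC ger0_norm ?lerDl ?oppr_ge0 ?subr_ge0 ltW// (lt_le_trans ha).
- by rewrite subrr normr0.
Qed.

Lemma sqpos_taylor (a b : R) :
  `|sqpos b - sqpos a - 2 * Num.max 0 a * (b - a)| <= (b - a) ^+ 2.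
Proof.
rewrite /sqpos; case: (lerP 0 a) => ha; case: (lerP 0 b) => hb.
- by rewrite ger0_norm; [|rewrite (_ : _ - _ = (b - a) ^+ 2) ?sqr_ge0//; ring]; nra.
- by rewrite ler_norml; apply/andP; split; nra.
- by rewrite expr0n mulr0 mul0r !subr0 ger0_norm ?sqr_ge0//; nra.
- by rewrite mulr0 mul0r !subr0 subrr normr0 sqr_ge0.
Qed.

Lemma is_derive_sqpos (y : R) : is_derive y 1 sqpos (2 * Num.max 0 y).
Proof.
suff cv : h^-1 *: (sqpos (h *: 1 + y) - sqpos y) @[h --> 0^'] --> 2 * Num.max 0 y.
  by apply: DeriveDef; [exact: cvgP cv|exact: cvg_lim cv].
apply/cvgrPdistC_le => e e0; near=> h.
have h0 : h != 0 by near: h; exact: nbhs_dnbhs_neq.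
have he : `|h| <= e by near: h; exact: dnbhs0_le.
have := sqpos_taylor y (h *: 1 + y).
have -> : h *: 1 + y - y = h :> R by rewrite addrK /GRing.scale /= mulr1.
set S := sqpos _ - sqpos y => ht.
have -> : h^-1 *: S - 2 * Num.max 0 y = h^-1 * (S - 2 * Num.max 0 y * h).
  by rewrite /GRing.scale /=; field.
rewrite normrM normfV (le_trans _ he)// ler_pdivrMl ?normr_gt0//.
by rewrite -expr2 real_normK ?num_real.
Unshelve. all: by end_near. Qed.

Lemma continuous_sqpos' : continuous (fun y : R => 2 * Num.max 0 y).
Proof.
move=> y; apply: cvgM; first exact: cvg_cst.
apply: (@lipschitz_continuous _ _ _ _ _ 1) => y'.
by rewrite mul1r max0_lipschitz.
Qed.

End Bump.

(** * Nets with bounded overlap *)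

Section Counting.
Variable R : realType.

Lemma card_window (P : nat) (S : pred 'I_P) (w : R) : 0 <= w ->
  (forall i j, S i -> S j -> (i : nat)%:R - (j : nat)%:R <= w) ->
  (#|S| <= (Num.truncn w).+1)%N.
Proof.
move=> w0 hS; set W := Num.truncn w.
have [/existsP[j0 Sj0]|/existsPn S0] := boolP [exists j, S j]; last first.
  by rewrite (eq_card0 (A := S))// => j; apply/negbTE; exact: S0.
case: (arg_minnP (fun j : 'I_P => j : nat) Sj0) => i0 Si0 imin.
have SW j : S j -> (j - i0 <= W)%N.
  move=> Sj; rewrite truncn_ge_nat// natrB ?imin//; exact: hS.
rewrite -(card_ord W.+1) -(@card_in_imset _ _ (fun j : 'I_P => inord (j - i0) : 'I_W.+1) S).
  exact: max_card.
move=> i j Si Sj /(congr1 val) /=; rewrite !inordK ?ltnS ?SW// => E.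
by apply: val_inj; rewrite /= -(subnK (imin i Si)) E subnK// imin.
Qed.

Lemma card_box (d P : nat) (S : 'I_d -> pred 'I_P) (N : nat) :
  (forall c, (#|S c| <= N)%N) ->
  (#|[pred f : {ffun 'I_d -> 'I_P} | [forall c, S c (f c)]]| <= N ^ d)%N.
Proof.
move=> h; have -> : #|[pred f : {ffun 'I_d -> 'I_P} | [forall c, S c (f c)]]| =
    #|(family S : simpl_pred {ffun 'I_d -> 'I_P})|.
  by apply: eq_card => f; apply/forallP/familyP.
rewrite card_family -[d in (N ^ d)%N](size_enum_ord d).
rewrite /image_mem; elim: (enum _) => //= c s IH; rewrite expnS leq_mul//; exact: h.
Qed.

Lemma card_fibers (I J : finType) (S : pred (I * J)) (A : pred I) (N1 N2 : nat) :
  (forall i j, S (i, j) -> A i) -> (#|A| <= N1)%N ->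
  (forall i, (#|[pred j | S (i, j)]| <= N2)%N) -> (#|S| <= N1 * N2)%N.
Proof.
move=> SA cA cS; rewrite -sum1_card.
have -> : (\sum_(x in S) 1 = \sum_(i | A i) \sum_(j | S (i, j)) 1)%N.
  rewrite pair_big_dep /=; apply: eq_bigl => -[i j] /=.
  by rewrite /in_mem /=; apply/idP/andP => [Sij|[]//]; split=> //; exact: SA Sij.
apply: (@leq_trans (\sum_(i | A i) N2)%N).
  by apply: leq_sum => i _; rewrite sum1_card; exact: cS.
by rewrite sum_nat_const leq_mul2r cA orbT.
Qed.

End Counting.

Section Net.
Variables (R : realType) (n k : nat).
Local Notation d := (hdim n k).
Local Notation pt := (hpoint R n k).
Implicit Types (phi : pt -> 'rV[R]_k) (M : pt -> 'M[R]_(k, d)).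

(** A substitute for the intrinsic distance from [y] to [a]: its sublevel set below
    1 is a box around [a] of intrinsic size [h]. The frame is frozen at [phi a], so
    it is a polynomial in [y] however irregular [phi] is. *)
Definition gauge phi (h : R) (a y : pt) : R :=
  h ^- 2 * (\sum_(c < d) (hproj y - hproj a) 0 c ^+ 2) +
  h ^- 4 * vdefect (phi a) y a ^+ 2.

Lemma gauge_lt1 phi h a y : 0 < h -> gauge phi h a y < 1 ->
  [/\ `|hproj y - hproj a| <= h, `|vdefect (phi a) y a| <= h ^+ 2 &
      intrinsic_dist phi y a <= h].
Proof.
move=> h0 g1.
have S0 : 0 <= \sum_(c < d) (hproj y - hproj a) 0 c ^+ 2.
  by rewrite sumr_ge0// => c _; exact: sqr_ge0.
have h2 : 0 < h ^- 2 by rewrite invr_gt0 exprn_gt0.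
have h4 : 0 < h ^- 4 by rewrite invr_gt0 exprn_gt0.
have e1 : enorm (hproj y - hproj a) <= h.
  rewrite /enorm -[leRHS](ger0_norm (ltW h0)) -[leRHS]sqrtr_sqr ler_wsqrtr//.
  rewrite -[leRHS]mul1r -ler_pdivrMr ?exprn_gt0// mulrC.
  by rewrite (le_trans _ (ltW g1))// /gauge lerDl mulr_ge0 ?(ltW h4) ?sqr_ge0.
have e2 : `|vdefect (phi a) y a| <= h ^+ 2.
  rewrite -ler_sqr ?nnegrE ?sqr_ge0// real_normK ?num_real// -exprM.
  rewrite -[leRHS]mul1r -ler_pdivrMr ?exprn_gt0// mulrC.
  by rewrite (le_trans _ (ltW g1))// /gauge lerDr mulr_ge0 ?(ltW h2).
split=> //; first exact: le_trans (norm_le_enorm _) e1.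
rewrite intrinsic_distE ge_max e1 /= -[leRHS](ger0_norm (ltW h0)) -[leRHS]sqrtr_sqr.
exact: ler_wsqrtr.
Qed.

Lemma gauge_le_half phi h a y (s E : R) : 0 < h -> 0 <= s -> 0 <= E ->
  `|hproj y - hproj a| <= s * h -> `|vdefect (phi a) y a| <= s * h ^+ 2 * E ->
  s ^+ 2 * (d%:R + E ^+ 2) <= 2^-1 -> gauge phi h a y <= 2^-1.
Proof.
move=> h0 s0 E0 hp hv hs; rewrite (le_trans _ hs)// mulrDr /gauge lerD//.
  rewrite mulrC ler_pdivrMr ?exprn_gt0//.
  rewrite [leRHS](_ : _ = d%:R * (s * h) ^+ 2); last by ring.
  rewrite [leRHS]mulr_natl -[X in _ *+ X]card_ord -sumr_const.
  apply: ler_sum => c _; rewrite -real_normK ?num_real// ler_pXn2r ?nnegrE ?mulr_ge0 ?(ltW h0)//.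
  by rewrite (le_trans _ hp)// mx_entry_le.
rewrite mulrC ler_pdivrMr ?exprn_gt0// -real_normK ?num_real//.
rewrite [leRHS](_ : _ = (s * h ^+ 2 * E) ^+ 2); last by ring.
have e0 : 0 <= s * h ^+ 2 * E by rewrite mulr_ge0// mulr_ge0// sqr_ge0.
by rewrite ler_pXn2r.
Qed.

Lemma vdefect_swap (y y' : 'rV[R]_k) (a b : pt) :
  vdefect y a b = - vdefect y' b a - pair (y - y') (eta_of (hproj a - hproj b)).
Proof.
rewrite /vdefect !eta_ofB !pairBr !pairBl (sigN (hproj a)); ring.
Qed.

Lemma vdefect_near (h B : R) (y : 'rV[R]_k) (a x : pt) : 0 <= h <= 1 -> `|y| <= B ->
  `|x| <= B -> `|hproj a - hproj x| <= h -> `|vdefect y a x| <= h ^+ 2 ->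
  `|a - x| <= h * (2 + k%:R * B + n%:R * B).
Proof.
move=> /andP[h0 h1] yB xB hp hv; have B0 : 0 <= B by rewrite (le_trans _ yB).
rewrite (decomp_lift y a x) (le_trans (ler_normD _ _))//.
have l1 : `|lift y (hproj a - hproj x) x| <= h * (1 + k%:R * B + n%:R * B).
  rewrite (le_trans (lift_norm _ _ _))// ler_pM// ?addr_ge0 ?mulr_ge0//.
  by rewrite !lerD// ler_wpM2l// (le_trans (hproj_norm _)).
have l2 : `|mkpt 0 (vdefect y a x) : pt| <= h.
  apply: hpoint_norm_le; rewrite ?hproj_mkpt ?normr0// taupart_mkpt.
  by rewrite (le_trans hv)// expr2 ler_piMl.
rewrite (le_trans (lerD l1 l2))// le_eqVlt; apply/orP; left; apply/eqP; ring.
Qed.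

Lemma vdefect_swap0 (y : 'rV[R]_k) (a b : pt) : vdefect y a b = - vdefect y b a.
Proof. by rewrite (vdefect_swap y y) subrr /pair big1 ?subr0// => j _; rewrite mxE mul0r. Qed.

Lemma grid_index (s z : R) (P : nat) : 0 < s -> 0 <= z -> z / s < P%:R ->
  exists j : 'I_P, `|z - s * (j : nat)%:R| <= s.
Proof.
move=> s0 z0 zP; have zs : 0 <= z / s by rewrite divr_ge0// ltW.
have /andP[t1 t2] := truncn_itv zs.
have tP : (Num.truncn (z / s) < P)%N by rewrite -(ltr_nat R) (le_lt_trans t1).
exists (Ordinal tP); rewrite /= ger0_norm.
  rewrite lerBlDl -[X in _ + X]mulr1 -mulrDr natr1.
  by rewrite mulrC -ler_pdivrMr// ltW.
by rewrite subr_ge0 mulrC -ler_pdivlMr.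
Qed.

(** Centres are taken on a grid of mesh [s * h] horizontally and [s * h ^+ 2]
    vertically. The frame at a centre depends on the centre, but within distance
    [h] of a given point it differs from the frame at that point by [O(h)], and so
    the vertical coordinates of the centres near that point lie, for each
    horizontal position, in a window of length [O(h ^+ 2)]. *)
Lemma net_exists phi (K : set pt) (B C r1 : R) : 0 < r1 -> 0 <= B -> 0 <= C ->
  (forall x, K x -> `|x| <= B) ->
  (forall x a, K x -> `|a - x| < r1 -> `|phi a| <= B) ->
  (forall x a b, K x -> `|a - x| < r1 -> `|b - x| < r1 ->
     `|phi b - phi a| <= C * intrinsic_dist phi b a) ->
  exists N : nat, forall h : R, 0 < h -> h <= 1 ->
    h * (2 + k%:R * B + n%:R * B) < r1 ->
  exists s : seq pt, (forall a, a \in s -> exists2 x, K x & `|a - x| < r1) /\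
    forall x, K x -> (exists2 a, a \in s & gauge phi h a x <= 2^-1) /\
      (count (fun a => (gauge phi h a x < 1)%R) s <= N)%N.
Proof.
move=> r1_gt0 B0 C0 KB phiB phiL.
pose E : R := 1 + k%:R * (C * (d%:R + 1)).
have E1 : 1 <= E by rewrite lerDl !mulr_ge0// addr_ge0.
have E0 : 0 <= E by rewrite (le_trans _ E1).
(* With this mesh the nearest centre has gauge at most 1/2; [E] accounts for
   the change of frame between the centre and the given point. *)
pose s : R := (2 * (d%:R + E))^-1.
have dE1 : 1 <= d%:R + E by rewrite (le_trans E1)// lerDr.
have dE0 : 0 < d%:R + E by rewrite (lt_le_trans ltr01).
have s0 : 0 < s by rewrite invr_gt0 mulr_gt0.
have s1 : s <= 1.
  rewrite invf_le1 ?mulr_gt0//; apply: le_trans dE1 _.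
  by rewrite ler_peMl ?ler1n// ltW.
have sE : s ^+ 2 * (d%:R + E ^+ 2) <= 2^-1.
  rewrite /s exprVn mulrC ler_pdivrMr ?exprn_gt0 ?mulr_gt0//.
  have dd : d%:R <= d%:R ^+ 2 :> R.
    by rewrite -natrX ler_nat; case: (d) => // m; rewrite expnS leq_pmulr.
  have dE : 0 <= d%:R * E by rewrite mulr_ge0.
  by nra.
pose rho : R := 2 + k%:R * B + n%:R * B.
have rho0 : 0 <= rho by rewrite !addr_ge0// mulr_ge0.
pose A : R := B + rho.
pose N1 := (Num.truncn (2 / s)).+1.
pose N2 := (Num.truncn (2 * (1 + k%:R * C) / s)).+1.
exists (N1 ^ d * N2)%N => h h0 h1 hr.
have h01 : 0 <= h <= 1 by rewrite ltW.
have sh0 : 0 < s * h by rewrite mulr_gt0.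
have shh0 : 0 < s * h ^+ 2 by rewrite mulr_gt0// exprn_gt0.
(* Grid coordinates are shifted by [B] and [A] to be indexed by natural numbers;
   [P] of them per axis suffice to reach all of [K]. *)
pose P := (Num.truncn (2 * A / (s * h ^+ 2))).+1.
have PA z : z <= 2 * A -> z / (s * h ^+ 2) < P%:R.
  move=> zA; rewrite (le_lt_trans _ (truncnS_gt _))// ler_wpM2r// invr_ge0 ltW//.
pose gridpt (i : {ffun 'I_d -> 'I_P} * 'I_P) : pt :=
  mkpt (\row_c (s * h * (i.1 c : nat)%:R - B)) (s * h ^+ 2 * (i.2 : nat)%:R - A).
pose near a := `[< exists2 x, K x & `|a - x| < r1 >].
pose net := [seq gridpt i | i <- enum {: {ffun 'I_d -> 'I_P} * 'I_P} & near (gridpt i)].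
have netP a : a \in net -> exists2 x, K x & `|a - x| < r1.
  by move=> /mapP[i]; rewrite mem_filter => /andP[/asboolP ? _] ->.
exists net; split=> // x Kx.
have xB := KB x Kx; have xx : `|x - x| < r1 by rewrite subrr normr0.
have phix := phiB x x Kx xx.
split.
  have hz c : exists j : 'I_P, `|(hproj x 0 c + B) - s * h * (j : nat)%:R| <= s * h.
    have xc : `|hproj x 0 c| <= B by rewrite (le_trans (mx_entry_le _ _ _))// (le_trans (hproj_norm _)).
    move: (xc); rewrite ler_norml => /andP[c1 c2].
    apply: grid_index => //; first by rewrite -lerBlDr sub0r.
    apply: le_lt_trans (PA (2 * B) _); last by rewrite ler_wpM2l// lerDl.
    apply: ler_pM; rewrite ?invr_ge0 ?(ltW sh0)//.
    - by rewrite -lerBlDr sub0r.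
    - by rewrite mulrDl mul1r lerD2r.
    - rewrite lef_pV2 ?posrE// ler_wpM2l ?(ltW s0)// expr2 ler_piMl// ltW//.
  have [m hm] := choice hz.
  pose p : 'rV[R]_d := \row_c (s * h * (m c : nat)%:R - B).
  have px : `|p - hproj x| <= s * h.
    apply/mx_norm_leP => [|i c]; first exact: ltW.
    have -> : (p - hproj x) i c = - (hproj x 0 c + B - s * h * (m c : nat)%:R).
      by rewrite (ord1 i) !mxE; ring.
    by rewrite normrN.
  have pxh : `|p - hproj x| <= h by rewrite (le_trans px)// ler_piMl// ltW.
  (* The vertical coordinate is rounded only after the horizontal ones: its
     target [t] is the height, above the rounded position, of the plane through [x]. *)
  pose t := taupart x + pair (phi x) (eta_of (p - hproj x)) - sig p (hproj x).
  have tA : `|t| <= A.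
    have -> : t = taupart (x + lift (phi x) (p - hproj x) x).
      rewrite taupartD taupart_lift sigBl sigxx subr0 /t; ring.
    rewrite (le_trans (taupart_norm _))// (le_trans (ler_normD _ _))// /A lerD//.
    set v := lift _ _ _; have ev : x + v - x = v by rewrite addrC addKr.
    have ep : hproj (x + v) - hproj x = p - hproj x by rewrite -hprojB ev hproj_lift.
    have := vdefect_near (a := x + v) h01 phix xB; rewrite ep ev vdefect_lift normr0.
    by move=> /(_ pxh (sqr_ge0 _)) l2; rewrite (le_trans l2)// ler_piMl.
  have [j hj] : exists j : 'I_P, `|(t + A) - s * h ^+ 2 * (j : nat)%:R| <= s * h ^+ 2.
    move: (tA); rewrite ler_norml => /andP[t1 t2].
    apply: grid_index => //; first by rewrite -lerBlDr sub0r.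
    by apply: PA; rewrite mulrDl mul1r lerD2r.
  pose i : {ffun 'I_d -> 'I_P} * 'I_P := ([ffun c => m c], j).
  have pi : hproj (gridpt i) = p.
    by rewrite hproj_mkpt; apply/rowP => c; rewrite !mxE ffunE.
  have vd : `|vdefect (phi x) (gridpt i) x| <= s * h ^+ 2.
    rewrite /vdefect pi taupart_mkpt /= distrC in hj *.
    by move: hj; rewrite /t => hj; rewrite (le_trans _ hj)// le_eqVlt; apply/orP; left; apply/eqP; congr (`|_|); ring.
  have vdh : `|vdefect (phi x) (gridpt i) x| <= h ^+ 2.
    by rewrite (le_trans vd)// ler_piMl// sqr_ge0.
  have ax : `|gridpt i - x| < r1.
    by rewrite (le_lt_trans _ hr)// (vdefect_near h01 phix)// pi.
  exists (gridpt i).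
    apply/mapP; exists i => //; rewrite mem_filter mem_enum andbT.
    by apply/asboolP; exists x.
  have dist : intrinsic_dist phi (gridpt i) x <= h * (d%:R + 1).
    rewrite intrinsic_distE ge_max pi; apply/andP; split.
      rewrite (le_trans (enorm_le_norm _))// mulrC ler_pM//.
      by rewrite lerDl.
    apply: (@le_trans _ _ h).
      by rewrite -[leRHS](ger0_norm (ltW h0)) -[leRHS]sqrtr_sqr ler_wsqrtr.
    by rewrite ler_peMr ?(ltW h0)// lerDr.
  apply: (gauge_le_half h0 (ltW s0) E0) sE; first by rewrite pi distrC.
  rewrite (vdefect_swap _ (phi x)) (le_trans (ler_normB _ _))// normrN.
  rewrite /E mulrDr mulr1 lerD//.
  rewrite (le_trans (pair_le _ _))//.
  have e1 : `|eta_of (hproj x - hproj (gridpt i))| <= s * h.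
    by rewrite (le_trans (eta_of_norm _))// pi distrC.
  have e2 : `|phi (gridpt i) - phi x| <= C * (h * (d%:R + 1)).
    by rewrite (le_trans (phiL x x _ Kx xx ax))// ler_wpM2l.
  have -> : s * h ^+ 2 * (k%:R * (C * (d%:R + 1))) = k%:R * (C * (h * (d%:R + 1))) * (s * h) by ring.
  by rewrite ler_pM// ?mulr_ge0// ler_wpM2l.
rewrite /net count_map count_filter -sum1_count big_enum_cond /= sum1_card.
set S := (X in #|X|).
have SP i j : S (i, j) ->
    `|hproj x - hproj (gridpt (i, j))| <= h /\
    `|vdefect (phi x) (gridpt (i, j)) x| <= h ^+ 2 * (1 + k%:R * C).
  rewrite /S /= /in_mem /= => /andP[/(gauge_lt1 h0)[g1 g2 g3] /asboolP[x' Kx' ax']].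
  split=> //.
  have phia := phiB _ _ Kx' ax'.
  have ax : `|gridpt (i, j) - x| < r1.
    rewrite (le_lt_trans _ hr)// (vdefect_near h01 phia)// 1?distrC//.
    by rewrite vdefect_swap0 normrN.
  rewrite (vdefect_swap _ (phi (gridpt (i, j)))) (le_trans (ler_normB _ _))// normrN.
  rewrite mulrDr mulr1 lerD// (le_trans (pair_le _ _))//.
  have e1 : `|eta_of (hproj (gridpt (i, j)) - hproj x)| <= h.
    by rewrite (le_trans (eta_of_norm _))// distrC.
  have e2 : `|phi x - phi (gridpt (i, j))| <= C * h.
    by rewrite (le_trans (phiL x _ x Kx ax xx))// ler_wpM2l.
  have -> : h ^+ 2 * (k%:R * C) = k%:R * (C * h) * h by ring.
  by rewrite ler_pM// ?mulr_ge0// ler_wpM2l.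
pose W c : pred 'I_P := fun i => `|hproj x 0 c - (s * h * (i : nat)%:R - B)| <= h.
apply: (@card_fibers _ _ _ [pred f : {ffun 'I_d -> 'I_P} | [forall c, W c (f c)]]).
- move=> i j /SP[h2 _]; apply/forallP => c; rewrite /W.
  by have := le_trans (mx_entry_le _ 0 c) h2; rewrite hproj_mkpt !mxE.
- apply: card_box => c; apply: (@card_window R); first by rewrite divr_ge0// ltW.
  move=> i j; rewrite /W => hi hj.
  rewrite ler_pdivlMr// -(ler_pM2r h0) -mulrA.
  have -> : ((i : nat)%:R - (j : nat)%:R) * (s * h) =
    (hproj x 0 c - (s * h * (j : nat)%:R - B)) - (hproj x 0 c - (s * h * (i : nat)%:R - B)) by ring.
  rewrite (le_trans (ler_norm _))// (le_trans (ler_normB _ _))// mulrDl mul1r.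
  exact: lerD.
- move=> i; apply: (@card_window R).
    by rewrite divr_ge0 ?(ltW s0)// mulr_ge0// addr_ge0// mulr_ge0.
  move=> j j' /= /SP[_ hj] /SP[_ hj'].
  have hh0 : 0 < h ^+ 2 by rewrite exprn_gt0.
  rewrite ler_pdivlMr// -(ler_pM2r hh0) -mulrA.
  have -> : ((j : nat)%:R - (j' : nat)%:R) * (s * h ^+ 2) =
     vdefect (phi x) (gridpt (i, j)) x - vdefect (phi x) (gridpt (i, j')) x.
    by rewrite /vdefect !hproj_mkpt !taupart_mkpt /=; ring.
  rewrite (le_trans (ler_norm _))// (le_trans (ler_normB _ _))//.
  have -> : 2 * (1 + k%:R * C) * h ^+ 2 =
    h ^+ 2 * (1 + k%:R * C) + h ^+ 2 * (1 + k%:R * C) by ring.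
  exact: lerD.
Qed.

End Net.

(** * Smoothing with intrinsic bumps *)

Section WeightedMeans.
Variables (R : realType) (T : eqType).
Implicit Types (s : seq T) (act : pred T) (F g : T -> R).

Lemma norm_sum_count s act F (c : R) : 0 <= c ->
  (forall a, a \in s -> ~~ act a -> F a = 0) -> (forall a, a \in s -> act a -> `|F a| <= c) ->
  `|\sum_(a <- s) F a| <= (count act s)%:R * c.
Proof.
move=> c0; elim: s => [|a s IH] h0 hc; first by rewrite big_nil normr0 mul0r.
rewrite big_cons /= (le_trans (ler_normD _ _))// natrD mulrDl lerD//; last first.
  by apply: IH => b bs; [apply: h0|apply: hc]; rewrite in_cons bs orbT.
have as_ : a \in a :: s by rewrite mem_head.
have [aa|na] := boolP (act a); first by rewrite mul1r hc.
by rewrite h0// normr0 mul0r.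
Qed.

Lemma norm_weighted_sum s act F g (c : R) :
  (forall a, a \in s -> 0 <= g a) -> (forall a, a \in s -> ~~ act a -> g a = 0) ->
  (forall a, a \in s -> act a -> `|F a| <= c) ->
  `|\sum_(a <- s) g a * F a| <= c * \sum_(a <- s) g a.
Proof.
move=> g0 ga Fc; rewrite mulr_sumr (le_trans (ler_norm_sum _ _ _))//.
rewrite big_seq [leRHS]big_seq; apply: ler_sum => a as_.
rewrite normrM ger0_norm ?g0// mulrC.
have [aa|na] := boolP (act a); first by rewrite ler_wpM2r ?g0// Fc.
by rewrite ga// !mulr0.
Qed.

(** The value and the derivative of a quotient [N / W], with [N] the weighted sum
    of the [t a] and [W] the total weight increased by [kap], against a reference
    value [p] and slope [m]. Since the [t a] are close to the common value [p],
    the derivatives [g' a] of the weights only enter multiplied by small factors. *)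
Lemma weighted_mean_estimate s act (g g' t t' : T -> R) (kap p m eta eta' c : R) (N : nat) :
  0 <= kap -> 0 <= eta -> 0 <= c -> (count act s <= N)%N ->
  (forall a, a \in s -> 0 <= g a) ->
  (forall a, a \in s -> ~~ act a -> g a = 0 /\ g' a = 0) ->
  (forall a, a \in s -> act a -> [/\ `|g' a| <= c, `|t a - p| <= eta & `|t' a - m| <= eta']) ->
  4^-1 <= \sum_(a <- s) g a ->
  let W := kap + \sum_(a <- s) g a in
  let S := \sum_(a <- s) g a * t a in
  let e := eta + 4 * kap * `|p| in
  `|S * W^-1 - p| <= e /\
  `|(\sum_(a <- s) (g' a * t a + g a * t' a)) * W^-1
      + S * - (W ^- 2 * \sum_(a <- s) g' a) - m|
    <= 4 * (N%:R * (c * eta)) + (eta' + 4 * kap * `|m|) + 4 * e * (N%:R * c).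
Proof.
move=> k0 eta0 c0 cN g0 g'0 act_ G4 W S e.
set G := \sum_(a <- s) g a in G4 W S e *.
have W4 : 4^-1 <= W by rewrite (le_trans G4)// lerDr.
have W0 : 0 < W by rewrite (lt_le_trans _ W4)// invr_gt0.
have Wi : W^-1 <= 4 by rewrite -[leRHS]invrK lef_pV2 ?posrE// invr_gt0.
have Wi0 : 0 <= W^-1 by rewrite invr_ge0 ltW.
have GW : G * W^-1 <= 1 by rewrite ler_pdivrMr// mul1r lerDr.
have G0 : 0 <= G by rewrite (le_trans _ G4)// invr_ge0.
have Sp : S - p * G = \sum_(a <- s) g a * (t a - p).
  by rewrite /S /G mulr_sumr -sumrB; apply: eq_bigr => a _; ring.
have h1 : `|S * W^-1 - p| <= e.
  have -> : S * W^-1 - p = (S - p * G) * W^-1 - kap * W^-1 * p.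
    by rewrite /W; field; rewrite -/W gt_eqF.
  rewrite (le_trans (ler_normB _ _))// /e lerD//.
    rewrite normrM (ger0_norm Wi0) Sp.
    have h : `|\sum_(a <- s) g a * (t a - p)| <= eta * G.
      apply: (@norm_weighted_sum s act) => // [a as_ na|a as_ aa].
        by case: (g'0 a as_ na).
      by case: (act_ a as_ aa).
    rewrite (le_trans (ler_wpM2r Wi0 h))// -mulrA ler_piMr//.
  by rewrite !normrM (ger0_norm k0) (ger0_norm Wi0) ler_wpM2r// mulrC ler_wpM2r.
split=> //.
set D := \sum_(a <- s) g' a.
have DN : `|D| <= N%:R * c.
  rewrite (le_trans (norm_sum_count (act := act) c0 _ _))//.
  - by move=> a as_ na; case: (g'0 a as_ na).
  - by move=> a as_ aa; case: (act_ a as_ aa).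
  - by rewrite ler_wpM2r// ler_nat.
have -> : (\sum_(a <- s) (g' a * t a + g a * t' a)) * W^-1 + S * - (W ^- 2 * D) - m =
  (\sum_(a <- s) g' a * (t a - p)) * W^-1
  + ((\sum_(a <- s) g a * (t' a - m)) * W^-1 - kap * W^-1 * m)
  - (S * W^-1 - p) * (W^-1 * D).
  have -> : \sum_(a <- s) g' a * (t a - p) = \sum_(a <- s) g' a * t a - p * D.
    by rewrite /D mulr_sumr -sumrB; apply: eq_bigr => a _; ring.
  have -> : \sum_(a <- s) g a * (t' a - m) = \sum_(a <- s) g a * t' a - m * G.
    by rewrite /G mulr_sumr -sumrB; apply: eq_bigr => a _; ring.
  have -> : \sum_(a <- s) (g' a * t a + g a * t' a) =
     \sum_(a <- s) g' a * t a + \sum_(a <- s) g a * t' a by rewrite big_split.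
  by rewrite /W; field; rewrite -/W gt_eqF.
rewrite (le_trans (ler_normB _ _))// lerD//; last first.
  rewrite normrM normrM (ger0_norm Wi0) [4 * e]mulrC -mulrA ler_pM//.
    by rewrite mulr_ge0.
  by rewrite ler_pM.
rewrite (le_trans (ler_normD _ _))// lerD//.
  rewrite normrM (ger0_norm Wi0) mulrC ler_pM//.
  rewrite (le_trans (norm_sum_count (act := act) (c := c * eta) _ _ _))//.
  - by rewrite mulr_ge0.
  - by move=> a as_ na; case: (g'0 a as_ na) => _ ->; rewrite mul0r.
  - by move=> a as_ aa; case: (act_ a as_ aa) => ? ? _; rewrite normrM ler_pM.
  - by rewrite ler_wpM2r ?mulr_ge0// ler_nat.
rewrite (le_trans (ler_normB _ _))// lerD//.
  have h : `|\sum_(a <- s) g a * (t' a - m)| <= eta' * G.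
    apply: (@norm_weighted_sum s act) => // [a as_ na|a as_ aa].
      by case: (g'0 a as_ na).
    by case: (act_ a as_ aa).
  have e'0 : 0 <= eta'.
    have G1 : 0 < G by rewrite (lt_le_trans _ G4)// invr_gt0.
    by rewrite -(pmulr_lge0 _ G1) (le_trans _ h).
  rewrite normrM (ger0_norm Wi0) (le_trans (ler_wpM2r Wi0 h))// -mulrA ler_piMr//.
rewrite !normrM (ger0_norm k0) (ger0_norm Wi0) ler_wpM2r// mulrC ler_wpM2r//.
Qed.

End WeightedMeans.

Section Smoothing.
Variables (R : realType) (n k : nat).
Local Notation d := (hdim n k).
Local Notation pt := (hpoint R n k).
Variables (phi : pt -> 'rV[R]_k) (M : pt -> 'M[R]_(k, d)) (h : R) (s : seq pt).
Hypothesis h0 : 0 < h.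

Definition bump (a y : pt) : R := sqpos (1 - gauge phi h a y).
Definition plane (a y : pt) : 'rV[R]_k := phi a + (hproj y - hproj a) *m (M a)^T.

(** A mean of the intrinsic tangent planes of [phi] at the centres, weighted by the
    bumps. The constant [h ^+ 2] keeps the denominator positive everywhere, so that
    the map is [C^1] on the whole space; it is negligible where the bumps are not
    all small. *)
Definition smooth (y : pt) : 'rV[R]_k :=
  \row_j ((\sum_(a <- s) bump a y * plane a y 0 j)
          * (h ^+ 2 + \sum_(a <- s) bump a y)^-1).

Definition dvdefect (a v : pt) : R :=
  taupart v - pair (phi a) (eta_of (hproj v)) + sig (hproj v) (hproj a).
Definition dgauge (a x v : pt) : R :=
  h ^- 2 * (\sum_(c <- enum 'I_d) 2 * ((hproj x - hproj a) 0 c * hproj v 0 c)) +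
  h ^- 4 * (2 * (vdefect (phi a) x a * dvdefect a v)).
Definition dbump (a x v : pt) : R := - dgauge a x v * (2 * Num.max 0 (1 - gauge phi h a x)).

Lemma bump_C1 a : C1_with (bump a) (dbump a).
Proof.
have V : C1_with (fun y => vdefect (phi a) y a) (fun _ => dvdefect a).
  apply: C1_affine.
  - by move=> v w; rewrite /dvdefect taupartD hprojD eta_ofD pairDr sigDl; ring.
  - by move=> c v; rewrite /dvdefect taupartZ hprojZ eta_ofZ pairZr sigZl; ring.
  - move=> y; have z0 : hproj (0 : pt) = 0 by rewrite -(scale0r (0 : pt)) hprojZ scale0r.
    have t0 : taupart (0 : pt) = 0 by rewrite -(scale0r (0 : pt)) taupartZ mul0r.
    rewrite /vdefect /dvdefect z0 t0 !eta_ofB !pairBr.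
    rewrite -[in eta_of 0](scale0r (0 : 'rV[R]_d)) eta_ofZ pairZr mul0r.
    by rewrite -[in sig 0 _](scale0r (0 : 'rV[R]_d)) sigZl mul0r; ring.
have H c : C1_with (fun y : pt => (hproj y - hproj a) 0 c) (fun _ v => hproj v 0 c).
  apply: (@C1_affine _ _ (fun v : pt => hproj v 0 c)).
  - by move=> v w; rewrite hprojD mxE.
  - by move=> t v; rewrite hprojZ mxE.
  - move=> y; have z0 : hproj (0 : pt) = 0 by rewrite -(scale0r (0 : pt)) hprojZ scale0r.
    by rewrite z0 sub0r [LHS]mxE [in RHS]addrC; congr (_ + _).
have G : C1_with (gauge phi h a) (dgauge a).
  apply: C1_ext (C1_add (C1_scale (h ^- 2) (C1_sum (enum 'I_d) (fun c => C1_mul (H c) (H c))))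
     (C1_scale (h ^- 4) (C1_mul V V))).
    by move=> y; rewrite /gauge big_enum; congr (_ * _ + _); apply: eq_bigr.
  move=> x v; rewrite /dgauge; congr (_ * _ + _ * _); last by ring.
  by apply: eq_bigr => c _; ring.
apply: C1_ext (C1_comp (@is_derive_sqpos R) (@continuous_sqpos' R)
   (C1_add (C1_cst _ 1) (C1_scale (-1) G))) => [y|x v].
  by rewrite mulN1r.
by rewrite /dbump add0r !mulN1r.
Qed.

Lemma plane_C1 a j : C1_with (fun y => plane a y 0 j) (fun _ v => (hproj v *m (M a)^T) 0 j).
Proof.
apply: (@C1_affine _ _ (fun v : pt => (hproj v *m (M a)^T) 0 j)).
- by move=> v w; rewrite hprojD mulmxDl mxE.
- by move=> t v; rewrite hprojZ -scalemxAl mxE.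
- move=> y; have z0 : hproj (0 : pt) = 0 by rewrite -(scale0r (0 : pt)) hprojZ scale0r.
  rewrite /plane z0 sub0r mulmxBl mulNmx !mxE.
  by rewrite -addrA; congr (_ + _); rewrite addrC.
Qed.

Lemma bump_ge0 a y : 0 <= bump a y. Proof. exact: sqr_ge0. Qed.

Lemma gauge_ge0 a y : 0 <= gauge phi h a y.
Proof.
rewrite addr_ge0// mulr_ge0 ?sqr_ge0 ?invr_ge0 ?exprn_ge0 ?(ltW h0)//.
by rewrite sumr_ge0// => c _; exact: sqr_ge0.
Qed.

Lemma weight_gt0 y : 0 < h ^+ 2 + \sum_(a <- s) bump a y.
Proof. by rewrite ltr_wpDr ?exprn_gt0// sumr_ge0// => a _; exact: bump_ge0. Qed.

Lemma smooth_C1 :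
  [/\ forall x, differentiable smooth x, forall A, C1_on A smooth &
   forall x v j, ('d smooth x v : 'rV_k) 0 j =
    (\sum_(a <- s) (dbump a x v * plane a x 0 j + bump a x * (hproj v *m (M a)^T) 0 j))
      * (h ^+ 2 + \sum_(a <- s) bump a x)^-1
    + (\sum_(a <- s) bump a x * plane a x 0 j)
      * - ((h ^+ 2 + \sum_(a <- s) bump a x) ^- 2 * \sum_(a <- s) dbump a x v)].
Proof.
have Nj j := C1_sum s (fun a => C1_mul (bump_C1 a) (plane_C1 a j)).
have W := C1_add (C1_cst _ (h ^+ 2)) (C1_sum s bump_C1).
have W0 y := lt0r_neq0 (weight_gt0 y).
have [d1 d2 d3] := C1_row (fun j => C1_mul (Nj j) (C1_inv W0 W)).
split=> // x v j; rewrite d2 mxE; congr (_ + _ * - (_ * _)).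
by rewrite add0r.
Qed.

Variables (x : pt) (B C eta : R) (N : nat).
Hypothesis h1 : h <= 1.
Hypothesis B0 : 0 <= B.
Hypothesis C0 : 0 <= C.
Hypothesis eta01 : 0 <= eta <= 1.
Hypothesis phix : `|phi x| <= B.
Hypothesis Mx : `|M x| <= B.
Hypothesis s_covers : exists2 a, a \in s & gauge phi h a x <= 2^-1.
Hypothesis s_count : (count (fun a => (gauge phi h a x < 1)%R) s <= N)%N.
Hypothesis s_close : forall a, a \in s -> gauge phi h a x < 1 ->
  [/\ `|phi x - phi a| <= C * intrinsic_dist phi x a,
      `|taylor_err phi (M a) a x| <= eta * intrinsic_dist phi x a & `|M a - M x| <= eta].

Lemma sum_bump_ge : 4^-1 <= \sum_(a <- s) bump a x.
Proof.
have [a as_ ga] := s_covers.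
rewrite (perm_big _ (perm_to_rem as_)) big_cons /=.
apply: (@le_trans _ _ (bump a x)); last by rewrite lerDl sumr_ge0// => b _; exact: bump_ge0.
rewrite /bump /sqpos; have h2 : 2^-1 <= 1 - gauge phi h a x by lra.
rewrite (_ : 4^-1 = 2^-1 ^+ 2); last by field.
rewrite ler_pXn2r ?nnegrE//; last by rewrite le_max lexx.
by rewrite le_max h2 orbT.
Qed.

(** [dbump_bound / h] bounds the derivatives of the bumps along the intrinsic fields
    of [smooth]. The slope of these fields is within [(1 + 4 * B + C) * h] of the
    slope frozen in the gauge, which makes the vertical term, of order [h ^- 2] per
    unit of height, as harmless as the horizontal ones. *)
Definition dbump_bound : R := 4 * (d%:R + (k%:R * (1 + 4 * B + C) + n%:R)).

Lemma bump_inactive a v : ~~ (gauge phi h a x < 1) -> bump a x = 0 /\ dbump a x v = 0.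
Proof.
rewrite -leNgt => g1; have e : Num.max 0 (1 - gauge phi h a x) = 0.
  by apply/max_idPl; rewrite subr_le0.
by rewrite /bump /sqpos /dbump e expr0n !mulr0.
Qed.

(** At [x] every tangent plane in the mean agrees with [phi x] up to [eta * h], by
    the Taylor estimate at its centre. The derivatives of the weights are of order
    [1 / h], so that their total contribution is of order [eta]; what remains is a
    mean of the slopes [M a], each close to [M x]. *)
Lemma smooth_estimate : let e := eta * h + 4 * h ^+ 2 * B in
  `|smooth x - phi x| <= e /\
  `|intrinsic_jacobian smooth x - M x| <=
    4 * (N%:R * (dbump_bound * eta)) + (d%:R * eta + 4 * h ^+ 2 * (d%:R * B))
    + 4 * (eta + 4 * h * B) * (N%:R * dbump_bound).
Proof.
move=> e; have /andP[eta0 eta1] := eta01.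
have cb0 : 0 <= dbump_bound.
  by rewrite /dbump_bound !mulr_ge0 ?addr_ge0 ?mulr_ge0 ?addr_ge0 ?mulr_ge0.
have hh0 : 0 <= h ^+ 2 by exact: sqr_ge0.
have plane_close a j : a \in s -> gauge phi h a x < 1 -> `|plane a x 0 j - phi x 0 j| <= eta * h.
  move=> as_ ga; have [_ t _] := s_close as_ ga; have [_ _ dh] := gauge_lt1 h0 ga.
  have -> : plane a x 0 j - phi x 0 j = - taylor_err phi (M a) a x 0 j.
    by rewrite /plane /taylor_err !mxE; ring.
  rewrite normrN (le_trans (mx_entry_le _ _ _))// (le_trans t)//.
  by rewrite ler_wpM2l.
have Mclose u a j : `|u| <= 1 -> a \in s -> gauge phi h a x < 1 ->
    `|(u *m (M a)^T) 0 j - (u *m (M x)^T) 0 j| <= d%:R * eta.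
  move=> u1 as_ ga; have [_ _ m] := s_close as_ ga.
  have -> : (u *m (M a)^T) 0 j - (u *m (M x)^T) 0 j = (u *m (M a - M x)^T) 0 j.
    by rewrite linearB /= mulmxBr !mxE.
  rewrite (le_trans (mx_entry_le _ _ _))// (le_trans (mulmx_norm_le _ _))//.
  by rewrite trmx_norm -mulrA ler_wpM2l// -[leRHS]mul1r ler_pM.
have smooth_close : `|smooth x - phi x| <= e.
  apply/mx_norm_leP => [|i j].
    by rewrite addr_ge0// !mulr_ge0// ltW.
  rewrite (ord1 i) mx_entryB [smooth x 0 j]mxE.
  have [||||||||H _] := @weighted_mean_estimate R _ s (fun a => gauge phi h a x < 1)
    (bump ^~ x) (fun=> 0) (fun a => plane a x 0 j) (fun=> 0)
    (h ^+ 2) (phi x 0 j) 0 (eta * h) 0 0 N.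
  - by [].
  - by rewrite mulr_ge0// ltW.
  - by [].
  - exact: s_count.
  - by move=> a _; exact: bump_ge0.
  - by move=> a _ na; split=> //; case: (bump_inactive 0 na).
  - by move=> a as_ ga; rewrite subr0 !normr0; split=> //; exact: plane_close.
  - exact: sum_bump_ge.
  rewrite (le_trans H)// lerD2l ler_wpM2l ?mulr_ge0 ?(ltW h0)//.
  by rewrite (le_trans (mx_entry_le _ _ _)).
split=> //.
have e_h : e <= (1 + 4 * B) * h.
  rewrite /e [leRHS]mulrDl lerD ?ler_wpM2r ?(ltW h0)//.
  rewrite (_ : 4 * h ^+ 2 * B = 4 * B * h * h); last by ring.
  by rewrite ler_piMr// !mulr_ge0// ltW.
rewrite intrinsic_jacobianE; last by case: smooth_C1.
have [sd _ dE] := smooth_C1.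
have db u a : `|u| <= 1 -> a \in s -> gauge phi h a x < 1 ->
    `|dbump a x (lift (smooth x) u x)| <= dbump_bound / h.
  move=> u1 as_ ga; have [l _ _] := s_close as_ ga.
  have [g1 g2 dh] := gauge_lt1 h0 ga.
  have pa : `|smooth x - phi a| <= (1 + 4 * B + C) * h.
    rewrite -(subrKA (phi x)) (le_trans (ler_normD _ _))// [leRHS]mulrDl lerD//.
      exact: le_trans e_h.
    by rewrite (le_trans l)// ler_wpM2l.
  have dv : `|dvdefect a (lift (smooth x) u x)| <= (k%:R * (1 + 4 * B + C) + n%:R) * h.
    have -> : dvdefect a (lift (smooth x) u x) =
      pair (smooth x - phi a) (eta_of u) - sig u (hproj x - hproj a).
      by rewrite /dvdefect taupart_lift hproj_lift pairBl sigBr; ring.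
    rewrite (le_trans (ler_normB _ _))// mulrDl lerD//.
      rewrite (le_trans (pair_le _ _))// -[leRHS]mulr1 ler_pM ?mulr_ge0//.
        by rewrite -mulrA ler_wpM2l.
      by rewrite (le_trans (eta_of_norm _)).
    rewrite (le_trans (sig_le _ _))// ler_pM ?mulr_ge0//.
    by rewrite -[leRHS]mulr1 ler_wpM2l.
  have dg : `|dgauge a x (lift (smooth x) u x)| <=
      2 * (d%:R + (k%:R * (1 + 4 * B + C) + n%:R)) / h.
    rewrite /dgauge hproj_lift (le_trans (ler_normD _ _))//.
    rewrite [2 * (d%:R + _)]mulrDr [leRHS]mulrDl lerD//.
      rewrite normrM ger0_norm ?invr_ge0// ler_pdivrMl ?exprn_gt0//.
      rewrite [leRHS](_ : _ = \sum_(c in 'I_d) 2 * h); last first.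
        by rewrite sumr_const card_ord -mulr_natl; field; rewrite gt_eqF.
      rewrite big_enum.
      rewrite (le_trans (ler_norm_sum _ _ _))//; apply: ler_sum => c _.
      rewrite normrM normrM ger0_norm// ler_wpM2l// -[leRHS]mulr1 ler_pM//.
        by rewrite (le_trans _ g1)// mx_entry_le.
      by rewrite (le_trans _ u1)// mx_entry_le.
    rewrite normrM ger0_norm ?invr_ge0 ?exprn_ge0 ?(ltW h0)// ler_pdivrMl ?exprn_gt0//.
    rewrite [leRHS](_ : _ = 2 * (h ^+ 2 * ((k%:R * (1 + 4 * B + C) + n%:R) * h))); last first.
      by field; rewrite gt_eqF.
    by rewrite normrM normrM ger0_norm// ler_wpM2l// ler_pM.
  rewrite /dbump normrM normrN.
  have mx : `|2 * Num.max 0 (1 - gauge phi h a x)| <= 2.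
    rewrite normrM ger0_norm// -[leRHS]mulr1 ler_wpM2l// ger0_norm ?le_max ?lexx//.
    by rewrite ge_max ler01 lerBlDl lerDr gauge_ge0.
  rewrite (le_trans (ler_pM _ _ dg mx))// /dbump_bound le_eqVlt; apply/orP; left.
  by apply/eqP; field; rewrite gt_eqF.
apply/mx_norm_leP => [|j c].
  have hge0 := ltW h0; apply: addr_ge0; first apply: addr_ge0.
  - by rewrite mulr_ge0// mulr_ge0// mulr_ge0.
  - by apply: addr_ge0; rewrite ?mulr_ge0.
  - apply: mulr_ge0; last by rewrite mulr_ge0.
    by rewrite mulr_ge0// addr_ge0// ?mulr_ge0.
pose u : 'rV[R]_d := delta_mx 0 c.
have u1 : `|u| <= 1 by rewrite delta_rV_norm.
have -> : (jac_matrix smooth x - M x) j c =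
  ('d smooth x (lift (smooth x) u x) : 'rV_k) 0 j - (u *m (M x)^T) 0 j.
  by rewrite -rowE !mxE.
rewrite dE hproj_lift.
set v := lift _ _ _.
have [||||||||_ H] := @weighted_mean_estimate R _ s (fun a => gauge phi h a x < 1)
    (bump ^~ x) (fun a => dbump a x v) (fun a => plane a x 0 j)
    (fun a => (u *m (M a)^T) 0 j)
    (h ^+ 2) (phi x 0 j) ((u *m (M x)^T) 0 j) (eta * h) (d%:R * eta) (dbump_bound / h) N.
- by [].
- by rewrite mulr_ge0// ltW.
- by rewrite divr_ge0// ltW.
- exact: s_count.
- by move=> a _; exact: bump_ge0.
- by move=> a _ na; exact: bump_inactive.
- move=> a as_ ga; split; [exact: db|exact: plane_close|exact: Mclose].
- exact: sum_bump_ge.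
rewrite (le_trans H)//.
have p1 : `|phi x 0 j| <= B by rewrite (le_trans (mx_entry_le _ _ _)).
have m1 : `|(u *m (M x)^T) 0 j| <= d%:R * B.
  rewrite (le_trans (mx_entry_le _ _ _))// (le_trans (mulmx_norm_le _ _))//.
  by rewrite trmx_norm -mulrA ler_wpM2l// -[leRHS]mul1r ler_pM.
rewrite lerD//; first rewrite lerD//.
- rewrite le_eqVlt; apply/orP; left; apply/eqP; field; by rewrite gt_eqF.
- by rewrite lerD2l ler_wpM2l// mulr_ge0.
- apply: (@le_trans _ _ (4 * (eta * h + 4 * h ^+ 2 * B) * (N%:R * (dbump_bound / h)))).
    have nn : 0 <= N%:R * (dbump_bound / h) by rewrite mulr_ge0// divr_ge0// ltW.
    rewrite ler_wpM2r// ler_wpM2l// lerD2l.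
    by rewrite ler_wpM2l// mulr_ge0.
  rewrite le_eqVlt; apply/orP; left; apply/eqP; field; by rewrite gt_eqF.
Qed.

End Smoothing.

(** * From uniform intrinsic differentiability to smooth approximations *)

Section Compactness.
Variable R : realType.

Lemma continuous_at_norm (V W : normedModType R) (f : V -> W) a :
  (forall e : R, 0 < e -> exists2 r : R, 0 < r & forall p, `|p - a| < r -> `|f p - f a| <= e) ->
  {for a, continuous f}.
Proof.
move=> H; apply/cvgrPdistC_le => e /H[r r0 hr]; apply/nbhs_ballP; exists r => //= p.
by rewrite -ball_normE /= distrC; exact: hr.
Qed.

Lemma continuous_within_open (V W : topologicalType) (A : set V) (f : V -> W) :
  open A -> (forall a, A a -> {for a, continuous f}) -> {within A, continuous f}.
Proof. by move=> oA h; rewrite continuous_open_subspace// => a /set_mem; exact: h. Qed.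

(** The radius is an argument of [Q] so that [Q] can also express bounds: with [r^-1]
    as the bound, locally bounded functions are bounded uniformly near [K]. *)
Lemma compact_uniform (V : normedModType R) (K : set V) (Q : R -> V -> V -> Prop) :
  compact K ->
  (forall x, K x -> exists2 r0 : R, 0 < r0 & forall r a b, 0 < r -> r < r0 ->
     `|a - x| < r0 -> `|b - x| < r0 -> Q r a b) ->
  exists2 r : R, 0 < r & forall x a b, K x -> `|a - x| < r -> `|b - x| < r -> Q r a b.
Proof.
move=> /compact_near_coveringP cK H.
have : \forall r \near (0 : R)^'+, K `<=` (fun x =>
    forall a b, `|a - x| < r -> `|b - x| < r -> Q r a b).
  apply: cK => x /H[r0 r0_gt0 hr0].
  exists (ball x (r0 / 2), [set r : R | 0 < r < r0 / 2]); first split => /=.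
  - by apply: nbhsx_ballx; rewrite divr_gt0.
  - have : \forall r \near (0 : R)^'+, r < r0 / 2 by apply: nbhs_right_lt; rewrite divr_gt0.
    have : \forall r \near (0 : R)^'+, 0 < r by exact: nbhs_right_gt.
    by apply: filterS2 => r r_gt0 rr; apply/andP.
  move=> [y r] /= [yx /andP[r_gt0 rr]] a b ay by_.
  move: yx; rewrite -ball_normE /= distrC => yx.
  have tri c : `|c - y| < r -> `|c - x| < r0.
    move=> cy; rewrite -(subrKA y) (le_lt_trans (ler_normD _ _))// [r0]splitr.
    by rewrite ltrD// (lt_trans cy).
  apply: hr0 => //; [|exact: tri|exact: tri].
  by rewrite (lt_trans rr)// ltr_pdivrMr// ltr_pMr// ltr1n.
move=> Hr; near (0 : R)^'+ => r; exists r; first by near: r; exact: nbhs_right_gt.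
move=> x a b Kx; have : K `<=` (fun x =>
    forall a b, `|a - x| < r -> `|b - x| < r -> Q r a b) by near: r.
by move=> /(_ x Kx); apply.
Unshelve. all: by end_near. Qed.

Lemma compact_norm_bounded (V : normedModType R) (K : set V) : compact K ->
  exists2 B : R, 0 <= B & forall x, K x -> `|x| <= B.
Proof.
move=> /compact_bounded[B [_ hB]]; exists (Num.max (B + 1) 0).
  by rewrite le_max lexx orbT.
by move=> x; apply: hB; rewrite lt_max ltrDl ltr01.
Qed.

End Compactness.

Section Approximation.
Variables (R : realType) (n k : nat).
Local Notation d := (hdim n k).
Local Notation pt := (hpoint R n k).
Variables (Omega : set pt) (phi : pt -> 'rV[R]_k) (M : pt -> 'M[R]_(k, d)).
Hypothesis oO : open Omega.
Hypothesis cphi : {within Omega, continuous phi}.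
Hypothesis uidM : forall a, Omega a -> uid_with phi (M a) a.

(** Near [x] the matrix [M a] leaves the same kind of error as [M x], so the two are
    close by [differential_close]; the Taylor estimate with the fixed matrix [M x]
    may then be restated with the matrix of the base point. *)
Lemma uid_near x (e : R) : Omega x -> 0 < e ->
  exists2 r : R, 0 < r & forall a b, `|a - x| < r -> `|b - x| < r ->
    [/\ Omega a, `|M a - M b| <= e &
        `|taylor_err phi (M a) a b| <= e * intrinsic_dist phi b a].
Proof.
move=> Ox e0; pose e1 : R := e / (4 * (d%:R + 1)).
have D0 : 0 < d%:R + 1 :> R by rewrite ltr_wpDl.
have e1_gt0 : 0 < e1 by rewrite divr_gt0// mulr_gt0.
have e1e : e1 * (4 * (d%:R + 1)) = e by rewrite divfK// gt_eqF// mulr_gt0.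
have [r1 r1_gt0 h1] := open_norm_ball oO Ox.
have [r2 r2_gt0 h2] := uidM Ox e1_gt0.
exists (Num.min r1 r2); first by rewrite lt_min r1_gt0.
have Mx a : `|a - x| < Num.min r1 r2 -> `|M x - M a| <= e1 + e1.
  rewrite lt_min => /andP[ar1 ar2].
  apply: (@differential_close _ _ _ phi _ _ a); first by rewrite addr_ge0// ltW.
    apply/nbhs_ballP; exists (r2 - `|a - x|) => /=; first by rewrite subr_gt0.
    move=> b; rewrite -ball_normE /= distrC => ba; apply: h2 => //.
    by rewrite -(subrKA a) (le_lt_trans (ler_normD _ _))// -ltrBrDr.
  have [r3 r3_gt0 h3] := uidM (h1 a ar1) e1_gt0.
  apply/nbhs_ballP; exists r3 => //= b; rewrite -ball_normE /= distrC => ba.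
  by apply: h3 => //; rewrite subrr normr0.
move=> a b ar br; split.
- by apply: h1; move: ar; rewrite lt_min => /andP[].
- rewrite -(subrKA (M x)) (le_trans (ler_normD _ _))// distrC.
  rewrite (le_trans (lerD (Mx a ar) (Mx b br)))// -e1e.
  have d0 : 0 <= d%:R :> R by []. nra.
- have t : `|taylor_err phi (M x) a b| <= e1 * intrinsic_dist phi b a.
    by move: ar br; rewrite !lt_min => /andP[_ ar] /andP[_ br]; exact: h2.
  set u := hproj b - hproj a.
  have -> : taylor_err phi (M a) a b = taylor_err phi (M x) a b + u *m (M x - M a)^T.
    by rewrite /taylor_err -/u linearB /= mulmxBr addrA subrK.
  have m : `|u *m (M x - M a)^T| <= d%:R * (e1 + e1) * intrinsic_dist phi b a.
    rewrite (le_trans (mulmx_norm_le _ _))// trmx_norm mulrAC ler_pM//.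
    - by rewrite ler_wpM2l// Mx.
    - exact: norm_le_dist.
  rewrite (le_trans (ler_normD _ _))// (le_trans (lerD t m))// -mulrDl.
  rewrite ler_wpM2r ?intrinsic_dist_ge0// -e1e.
  have d0 : 0 <= d%:R :> R by []. nra.
Qed.

Lemma uid_differential_continuous : {within Omega, continuous M}.
Proof.
apply: continuous_within_open => // x Ox; apply: continuous_at_norm => e e0.
have [r r0 hr] := uid_near Ox e0; exists r => // p pr.
by have [|_ + _] := hr p x pr; rewrite ?subrr ?normr0.
Qed.

Lemma smoothing_on_compact (K : set pt) (e : R) : compact K -> K `<=` Omega -> 0 < e ->
  exists psi : pt -> 'rV[R]_k, (forall A, C1_on A psi) /\
    forall x, K x -> `|psi x - phi x| <= e /\ `|intrinsic_jacobian psi x - M x| <= e.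
Proof.
move=> cK KO e0.
have [r1 r1_gt0 H1] : exists2 r : R, 0 < r & forall x a b, K x ->
    `|a - x| < r -> `|b - x| < r ->
    [/\ `|phi a| <= r^-1, `|M a| <= r^-1 &
        `|taylor_err phi (M a) a b| <= intrinsic_dist phi b a].
  apply: (compact_uniform (Q := fun r a b => [/\ `|phi a| <= r^-1, `|M a| <= r^-1 &
    `|taylor_err phi (M a) a b| <= intrinsic_dist phi b a])) => // x /KO Ox.
  have [s1 s1_gt0 h1] := uid_near Ox ltr01.
  have [s2 s2_gt0 h2] := continuous_norm_ball (within_open_continuous oO cphi Ox) ltr01.
  pose D : R := `|phi x| + `|M x| + 1.
  have D0 : 0 < D by rewrite ltr_wpDl// addr_ge0.
  exists (Num.min D^-1 (Num.min s1 s2)); first by rewrite !lt_min invr_gt0 D0 s1_gt0.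
  move=> r a b r0; rewrite !lt_min => /andP[rD _] /and3P[_ a1 a2] /and3P[_ b1 _].
  have Dr : D <= r^-1 by rewrite -[D]invrK lef_pV2 ?posrE ?invr_gt0// ltW.
  have [|_ m _] := h1 a x a1; first by rewrite subrr normr0.
  have [_ _ t] := h1 a b a1 b1; split; last by rewrite (le_trans t)// mul1r.
    rewrite (le_trans _ Dr)// -[phi a](subrK (phi x)) (le_trans (ler_normD _ _))//.
    by rewrite /D addrC -addrA lerD2l (le_trans (ltW (h2 a a2)))// lerDr.
  rewrite (le_trans _ Dr)// -[M a](subrK (M x)) (le_trans (ler_normD _ _))//.
  by rewrite /D addrC -[leRHS]addrA ler_wpDl// lerD2l.
have [B1 B1_ge0 KB1] := compact_norm_bounded cK.
pose B := Num.max r1^-1 B1.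
have B0 : 0 <= B by rewrite le_max B1_ge0 orbT.
have r1B : r1^-1 <= B by rewrite le_max lexx.
pose C : R := 1 + d%:R * B.
have C0 : 0 <= C by rewrite addr_ge0// mulr_ge0.
have KB x : K x -> `|x| <= B by move=> /KB1 h; rewrite (le_trans h)// le_max lexx orbT.
have phiB x a : K x -> `|a - x| < r1 -> `|phi a| <= B.
  by move=> Kx ar; have [h _ _] := H1 x a a Kx ar ar; rewrite (le_trans h).
have phiL x a b : K x -> `|a - x| < r1 -> `|b - x| < r1 ->
    `|phi b - phi a| <= C * intrinsic_dist phi b a.
  move=> Kx ar br; have [_ m t] := H1 x a b Kx ar br.
  have -> : phi b - phi a = taylor_err phi (M a) a b + (hproj b - hproj a) *m (M a)^T.
    by rewrite /taylor_err subrK.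
  rewrite (le_trans (ler_normD _ _))// mulrDl mul1r lerD//.
  rewrite (le_trans (mulmx_norm_le _ _))// trmx_norm mulrAC ler_pM//.
    by rewrite ler_wpM2l// (le_trans m).
  exact: norm_le_dist.
have [N HN] := net_exists r1_gt0 B0 C0 KB phiB phiL.
pose c := dbump_bound n k B C.
have c0 : 0 <= c.
  by rewrite /c /dbump_bound mulr_ge0// addr_ge0// addr_ge0// mulr_ge0// addr_ge0// addr_ge0// mulr_ge0.
have Nc0 : 0 <= N%:R * c by rewrite mulr_ge0.
(* [eta] and then [h] are taken so small that the bounds of [smooth_estimate], where
   [kap] is [h ^+ 2], split into two halves of [e]. *)
pose E1 : R := 8 * (N%:R * c) + d%:R + 1.
have E1_ge1 : 1 <= E1 by rewrite /E1 lerDr addr_ge0// mulr_ge0.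
have E1_gt0 : 0 < E1 by rewrite (lt_le_trans ltr01).
pose eta : R := Num.min 1 (e / 2 / E1).
have eta0 : 0 < eta by rewrite lt_min ltr01 !divr_gt0.
have etaE : eta * E1 <= e / 2 by rewrite -ler_pdivlMr// ge_min lexx orbT.
have [r2 r2_gt0 H2] : exists2 r : R, 0 < r & forall x a b, K x ->
    `|a - x| < r -> `|b - x| < r ->
    `|M a - M b| <= eta /\ `|taylor_err phi (M a) a b| <= eta * intrinsic_dist phi b a.
  apply: (compact_uniform (Q := fun _ a b => `|M a - M b| <= eta /\
    `|taylor_err phi (M a) a b| <= eta * intrinsic_dist phi b a)) => // x /KO Ox.
  have [s s_gt0 h] := uid_near Ox eta0; exists s => // _ a b _ _ ax bx.
  by have [] := h a b ax bx.
pose rho : R := 2 + k%:R * B + n%:R * B.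
have rho0 : 0 < rho by rewrite ltr_wpDr ?mulr_ge0// ltr_wpDr ?mulr_ge0.
pose E2 : R := 4 * (d%:R * B) + 16 * B * (N%:R * c) + 4 * B + 1.
have E2_ge1 : 1 <= E2.
  have z1 : 0 <= 4 * (d%:R * B) by rewrite mulr_ge0// mulr_ge0.
  have z2 : 0 <= 16 * B * (N%:R * c) by rewrite mulr_ge0// mulr_ge0.
  by rewrite /E2; lra.
have E2_gt0 : 0 < E2 by rewrite (lt_le_trans ltr01).
pose h : R := Num.min 1 (Num.min (e / 2 / E2) (Num.min r1 r2 / 2 / rho)).
have r12 : 0 < Num.min r1 r2 by rewrite lt_min r1_gt0.
have h0 : 0 < h by rewrite !lt_min ltr01 !divr_gt0.
have h1 : h <= 1 by rewrite ge_min lexx.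
have hE : h * E2 <= e / 2 by rewrite -ler_pdivlMr// !ge_min lexx !orbT.
have hrho : h * rho < Num.min r1 r2.
  apply: (@le_lt_trans _ _ (Num.min r1 r2 / 2)).
    by rewrite -ler_pdivlMr// !ge_min lexx !orbT.
  by rewrite ltr_pdivrMr// ltr_pMr// ltr1n.
have hr1 : h * rho < r1 by rewrite (lt_le_trans hrho)// ge_min lexx.
have [s [s_near s_prop]] := HN h h0 h1 hr1.
exists (smooth phi M h s); split; first by case: (smooth_C1 phi M s h0).
move=> x Kx; have [s_covers s_count] := s_prop x Kx.
have x1 : `|x - x| < r1 by rewrite subrr normr0.
have x2 : `|x - x| < r2 by rewrite subrr normr0.
have Mx : `|M x| <= B by have [_ m _] := H1 x x x Kx x1 x1; rewrite (le_trans m).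
have eta01 : 0 <= eta <= 1 by rewrite ltW//= ge_min lexx.
have s_close a : a \in s -> gauge phi h a x < 1 ->
  [/\ `|phi x - phi a| <= C * intrinsic_dist phi x a,
      `|taylor_err phi (M a) a x| <= eta * intrinsic_dist phi x a & `|M a - M x| <= eta].
  move=> /s_near[x' Kx' ax'] /(gauge_lt1 h0)[g1 g2 _].
  have ax : `|a - x| < Num.min r1 r2.
    rewrite (le_lt_trans _ hrho)//; apply: (vdefect_near (y := phi a)).
    - by rewrite ltW.
    - exact: phiB Kx' ax'.
    - exact: KB.
    - by rewrite distrC.
    - by rewrite vdefect_swap0 normrN.
  move: ax; rewrite lt_min => /andP[ax1 ax2].
  have [m t] := H2 x a x Kx ax2 x2; split=> //.
  exact: phiL ax1 x1.
have [e1 e2] := smooth_estimate h0 h1 B0 C0 eta01 (phiB x x Kx x1) Mx s_covers s_count s_close.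
rewrite -/c in e2.
have etaN : 0 <= eta * (8 * (N%:R * c)) by rewrite mulr_ge0 ?(ltW eta0)// mulr_ge0.
have etad : 0 <= eta * d%:R by rewrite mulr_ge0// ltW.
have hge0 := ltW h0.
have hdB : 0 <= h * (d%:R * B) by rewrite mulr_ge0// mulr_ge0.
have hBN : 0 <= h * (B * (N%:R * c)) by rewrite mulr_ge0// mulr_ge0.
have hB : 0 <= h * B by rewrite mulr_ge0// ltW.
have hh (z : R) : 0 <= z -> h ^+ 2 * z <= h * z.
  by move=> z0; rewrite ler_wpM2r// expr2 ler_piMr// ltW.
have eh : eta * h <= eta by rewrite ler_piMr// ltW.
have E1E : eta * E1 = eta * (8 * (N%:R * c)) + eta * d%:R + eta by rewrite /E1; ring.
have E2E : h * E2 = 4 * (h * (d%:R * B)) + 16 * (h * (B * (N%:R * c))) + 4 * (h * B) + h.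
  by rewrite /E2; ring.
have q1 := hh _ B0; have q2 := hh _ (mulr_ge0 (ler0n R d) B0).
split.
  by rewrite (le_trans e1)//; move: (ltW eta0) (ltW h0); lra.
rewrite (le_trans e2)//.
rewrite (_ : _ + _ = eta * (8 * (N%:R * c)) + eta * d%:R + 4 * (h ^+ 2 * (d%:R * B))
   + 16 * (h * (B * (N%:R * c)))); last by ring.
by move: (ltW eta0) (ltW h0); lra.
Qed.

(** The sets on the right are compact subsets of [Omega] by [compact_inner]. A
    map that is within [e] of the target on the set of parameter [e] thus serves
    all compactly contained open sets at once. *)
Lemma compact_exhaustion (K : set pt) : compact K -> K `<=` Omega ->
  \forall e \near (0 : R)^'+, K `<=` [set x | `|x| <= e^-1 /\ forall y, `|y - x| < e -> Omega y].
Proof.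
move=> cK KO.
have [r r0 hr] : exists2 r : R, 0 < r & forall x a b, K x ->
    `|a - x| < r -> `|b - x| < r -> `|a| <= r^-1 /\ Omega b.
  apply: (compact_uniform (Q := fun r a b => `|a| <= r^-1 /\ Omega b)) => // x /KO Ox.
  have [s s0 hs] := open_norm_ball oO Ox.
  have D0 : 0 < `|x| + s by rewrite ltr_wpDl.
  exists (Num.min s (`|x| + s)^-1); first by rewrite lt_min s0 invr_gt0.
  move=> r a b r0; rewrite !lt_min => /andP[_ rD] /andP[a1 _] /andP[b1 _].
  split; last exact: hs.
  rewrite (@le_trans _ _ (`|x| + s))//.
    by rewrite -[a](subrK x) (le_trans (ler_normD _ _))// addrC lerD2l ltW.
  by rewrite -[leLHS]invrK lef_pV2 ?posrE ?invr_gt0// ltW.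
near=> e.
have e0 : 0 < e by near: e; exact: nbhs_right_gt.
have er : e < r by near: e; exact: nbhs_right_lt.
move=> x Kx; have xr : `|x - x| < r by rewrite subrr normr0.
split=> [|y yx]; last by have [] := hr x x y Kx xr (lt_trans yx er).
have [h _] := hr x x x Kx xr xr; rewrite (le_trans h)// lef_pV2 ?posrE// ltW//.
Unshelve. all: by end_near. Qed.

Lemma compact_inner (e : R) : 0 < e ->
  compact [set x : pt | `|x| <= e^-1 /\ forall y, `|y - x| < e -> Omega y].
Proof.
move=> e0; apply: bounded_closed_compact.
  by exists e^-1; split=> [|r er x [xe _]]; [exact: num_real|rewrite /= (le_trans xe)// ltW].
move=> x cx; split.
  have := @closed_norm_ball R pt 0 e^-1 x; rewrite /= subr0; apply.
  by move=> A /cx[y [[y1 _] Ay]]; exists y; split=> //=; rewrite subr0.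
move=> y yx.
have /cx[z [[_ hz] xz]] : nbhs x (ball x (e - `|y - x|)).
  by apply: nbhsx_ballx; rewrite subr_gt0.
apply: hz; move: xz; rewrite -ball_normE /= => xz.
by rewrite -(subrKA x) (le_lt_trans (ler_normD _ _))// addrC -ltrBrDr.
Qed.

Theorem approximation_of_uid :
  exists phi_ : R -> pt -> 'rV[R]_k,
    (forall eps : R, 0 < eps -> C1_on Omega (phi_ eps)) /\
    forall Omega' : set pt, open Omega' -> compactly_inside Omega' Omega ->
      {uniform Omega', phi_ eps @[eps --> (0 : R)^'+] --> phi} /\
      {uniform Omega', intrinsic_jacobian (phi_ eps) @[eps --> (0 : R)^'+] --> M}.
Proof.
have ex (e : R) : exists psi : pt -> 'rV[R]_k, 0 < e -> (forall A, C1_on A psi) /\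
    forall x, `|x| <= e^-1 /\ (forall y, `|y - x| < e -> Omega y) ->
    `|psi x - phi x| <= e /\ `|intrinsic_jacobian psi x - M x| <= e.
  have [e0|e0] := ltrP 0 e; last by exists phi.
  have [|psi [C1 h]] := smoothing_on_compact (compact_inner e0) _ e0.
    by move=> x [_]; apply; rewrite subrr normr0.
  by exists psi.
have [phi_ hphi] := choice ex; exists phi_; split.
  by move=> e e0; have [C1 _] := hphi e e0; exact: C1.
move=> Omega' _ [cO' sO']; have exh := compact_exhaustion cO' sO'.
split; apply/uniform_cvgP => eps eps0; near=> e.
- have e0 : 0 < e by near: e; exact: nbhs_right_gt.
  have ee : e < eps by near: e; exact: nbhs_right_lt.
  have hK : closure Omega' `<=` [set x | `|x| <= e^-1 /\ forall y, `|y - x| < e -> Omega y].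
    by near: e.
  move=> x /(@subset_closure _ Omega')/hK Kx; rewrite distrC (le_lt_trans _ ee)//.
  by have [_ /(_ x Kx)[]] := hphi e e0.
- have e0 : 0 < e by near: e; exact: nbhs_right_gt.
  have ee : e < eps by near: e; exact: nbhs_right_lt.
  have hK : closure Omega' `<=` [set x | `|x| <= e^-1 /\ forall y, `|y - x| < e -> Omega y].
    by near: e.
  move=> x /(@subset_closure _ Omega')/hK Kx; rewrite distrC (le_lt_trans _ ee)//.
  by have [_ /(_ x Kx)[]] := hphi e e0.
Unshelve. all: by end_near. Qed.

End Approximation.

Theorem theorem1p3 (R : realType) (n k : nat) (hk : (1 <= k)%N) (hkn : (k <= n)%N)
    (Omega : set (hpoint R n k)) (hOmega : open Omega)
    (phi : hpoint R n k -> 'rV[R]_k) (hphi : {within Omega, continuous phi}) :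
  uniformly_intrinsic_differentiable Omega phi <->
  exists (phi_ : R -> hpoint R n k -> 'rV[R]_k)
         (M : hpoint R n k -> 'M[R]_(k, hdim n k)),
    [/\ forall eps : R, 0 < eps -> C1_on Omega (phi_ eps),
        {within Omega, continuous M} &
        forall Omega' : set (hpoint R n k),
          open Omega' -> compactly_inside Omega' Omega ->
          {uniform Omega', phi_ eps @[eps --> (0 : R)^'+] --> phi} /\
          {uniform Omega',
             intrinsic_jacobian (phi_ eps) @[eps --> (0 : R)^'+] --> M}].
Proof.
split=> [uid|[phi_ [M [C1 cM cvg]]] a0 Oa0]; last first.
  apply: uid_with_at; exact: uid_of_approximation hOmega hphi C1 cM cvg a0 Oa0.
have ex a : exists Ma, Omega a -> uid_with phi Ma a.
  have [Oa|nOa] := pselect (Omega a); last by exists 0.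
  by have [Ma hMa] := uid_at_with (uid a Oa); exists Ma.
have [M hM] := choice ex.
have [phi_ [C1 cvg]] := approximation_of_uid hOmega hphi hM.
exists phi_, M; split=> //; exact: uid_differential_continuous hOmega hM.
Qed.
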